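(* Let $R$ be an indecomposable commutative ring with $1$, and let $(n_1,\dots,n_k)$ and $(m_1,\dots,m_l)$ be (weakly) increasing tuples of integers $\ge 2$. If there exists an isomorphism of $R$-algebras $$\varphi:\bigotimes_{i=1}^k L_{n_i,R}\to\bigotimes_{j=1}^l L_{m_j,R}$$ such that $\varphi\left(\bigotimes_{i=1}^k D_{n_i,R}\right)\subseteq\bigotimes_{j=1}^l D_{m_j,R}$, then $k=l$ and $(n_1,\dots,n_k)=(m_1,\dots,m_k)$.
   Context: All tensor products are over $R$, and $k,l\ge1$. A commutative unital ring is indecomposable if it is nonzero and $0$ and $1$ are its only idempotents. For $2\le n<\infty$, the Leavitt algebra $L_{n,R}$ is the universal unital $R$-algebra generated by symbols $e_1,\dots,e_n,e_1^*,\dots,e_n^*$ subject to the relations $e_i^*e_j=\delta_{ij}$ and $\sum_{i=1}^n e_ie_i^*=1$. Its diagonal subalgebra $D_{n,R}$ is the $R$-subalgebra generated by the commuting idempotents $e_{i_1}\cdots e_{i_k}e_{i_k}^*\cdots e_{i_1}^*$, $1\le i_1,\dots,i_k\le n$ (of all lengths $k$). $\bigotimes_i D_{n_i,R}$ is regarded as the subalgebra of $\bigotimes_i L_{n_i,R}$ spanned by the elementary tensors with entries in the $D_{n_i,R}$. *)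

(* Defs.v *)
From HB Require Import structures.
From mathcomp Require Import all_boot all_algebra.
From mathcomp Require Import boolp.

Set Implicit Arguments.
Unset Strict Implicit.
Unset Printing Implicit Defensive.

Import GRing.Theory.
Local Open Scope ring_scope.
Local Open Scope quotient_scope.

(* Associative unital R-algebras. MathComp's [algType] excludes the zero ring,
   which quotient constructions such as tensor products may produce. The scaling
   is part of the mixin because Hierarchy Builder does not accept a new structure
   below [algType] that joins [pzRingType] and [lmodType]. *)
HB.mixin Record PzRing_isUAlgebra (R : comNzRingType) A of GRing.PzRing A := {
  ualg_scale : R -> A -> A;
  ualg_scaleA_subproof : forall r s x,
    ualg_scale r (ualg_scale s x) = ualg_scale (r * s) x;
  ualg_scale1_subproof : left_id 1 ualg_scale;
  ualg_scaleDr_subproof : right_distributive ualg_scale +%R;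
  ualg_scaleDl_subproof : forall x, {morph ualg_scale^~ x : r s / r + s};
  ualg_scaleAl_subproof : forall r x y,
    ualg_scale r (x * y) = ualg_scale r x * y;
  ualg_scaleAr_subproof : forall r x y,
    ualg_scale r (x * y) = x * ualg_scale r y
}.

#[short(type="ualgType")]
HB.structure Definition UAlgebra (R : comNzRingType) :=
  {A of GRing.PzRing A & PzRing_isUAlgebra R A}.

HB.instance Definition _ (R : comNzRingType) (A : ualgType R) :=
  GRing.Zmodule_isLmodule.Build R (UAlgebra.sort A)
    ualg_scaleA_subproof ualg_scale1_subproof
    ualg_scaleDr_subproof ualg_scaleDl_subproof.

Lemma ualg_scalerAl (R : comNzRingType) (A : ualgType R) (r : R) (x y : A) :
  r *: (x * y) = (r *: x) * y.
Proof. exact: ualg_scaleAl_subproof. Qed.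

Lemma ualg_scalerAr (R : comNzRingType) (A : ualgType R) (r : R) (x y : A) :
  r *: (x * y) = x * (r *: y).
Proof. exact: ualg_scaleAr_subproof. Qed.

(* That [R] is nonzero is part of [comNzRingType]. *)
Definition indecomposable (R : comNzRingType) : Prop :=
  forall e : R, e * e = e -> e = 0 \/ e = 1.

Inductive generated_subalgebra (R : comNzRingType) (A : ualgType R)
    (S : A -> Prop) : A -> Prop :=
| gsub_gen x : S x -> generated_subalgebra S x
| gsub_one : generated_subalgebra S 1
| gsub_add x y : generated_subalgebra S x -> generated_subalgebra S y ->
    generated_subalgebra S (x + y)
| gsub_scale r x : generated_subalgebra S x -> generated_subalgebra S (r *: x)
| gsub_mul x y : generated_subalgebra S x -> generated_subalgebra S y ->
    generated_subalgebra S (x * y).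

Inductive linear_span (R : comNzRingType) (V : lmodType R)
    (S : V -> Prop) : V -> Prop :=
| lspan_gen x : S x -> linear_span S x
| lspan_zero : linear_span S 0
| lspan_add x y : linear_span S x -> linear_span S y -> linear_span S (x + y)
| lspan_scale r x : linear_span S x -> linear_span S (r *: x).

Section Presentation.
Variables (R : comNzRingType) (X : Type).

Inductive alg_term : Type :=
| Gen of X
| Const of R
| Add of alg_term & alg_term
| Mul of alg_term & alg_term.

HB.instance Definition _ := gen_eqMixin alg_term.
HB.instance Definition _ := gen_choiceMixin alg_term.

Variable rel : alg_term -> alg_term -> Prop.

Inductive alg_cong : alg_term -> alg_term -> Prop :=
| ac_refl a : alg_cong a a
| ac_sym a b : alg_cong a b -> alg_cong b a
| ac_trans b a c : alg_cong a b -> alg_cong b c -> alg_cong a c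
| ac_add a a' b b' : alg_cong a a' -> alg_cong b b' ->
    alg_cong (Add a b) (Add a' b')
| ac_mul a a' b b' : alg_cong a a' -> alg_cong b b' ->
    alg_cong (Mul a b) (Mul a' b')
| ac_addA a b c : alg_cong (Add a (Add b c)) (Add (Add a b) c)
| ac_addC a b : alg_cong (Add a b) (Add b a)
| ac_add0 a : alg_cong (Add (Const 0) a) a
| ac_addN a : alg_cong (Add (Mul (Const (- 1)) a) a) (Const 0)
| ac_mulA a b c : alg_cong (Mul a (Mul b c)) (Mul (Mul a b) c)
| ac_mul1 a : alg_cong (Mul (Const 1) a) a
| ac_mulDl a b c : alg_cong (Mul (Add a b) c) (Add (Mul a c) (Mul b c))
| ac_mulDr a b c : alg_cong (Mul a (Add b c)) (Add (Mul a b) (Mul a c))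
| ac_constD r s : alg_cong (Const (r + s)) (Add (Const r) (Const s))
| ac_constM r s : alg_cong (Const (r * s)) (Mul (Const r) (Const s))
| ac_constC r a : alg_cong (Mul (Const r) a) (Mul a (Const r))
| ac_rel a b : rel a b -> alg_cong a b.

Definition alg_congb (a b : alg_term) : bool := `[< alg_cong a b >].

Lemma alg_congb_refl : reflexive alg_congb.
Proof. by move=> a; apply/asboolP/ac_refl. Qed.

Lemma alg_congb_sym : symmetric alg_congb.
Proof. by move=> a b; apply/asboolP/asboolP; apply: ac_sym. Qed.

Lemma alg_congb_trans : transitive alg_congb.
Proof.
by move=> b a c /asboolP ab /asboolP bc; apply/asboolP/(ac_trans ab bc).
Qed.

Canonical alg_cong_equiv :=
  EquivRel alg_congb alg_congb_refl alg_congb_sym alg_congb_trans.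

Definition presented := {eq_quot alg_cong_equiv}.

HB.instance Definition _ := Choice.on presented.

Definition pclass (a : alg_term) : presented := \pi a.

Lemma pclassP a b : pclass a = pclass b <-> alg_cong a b.
Proof.
split; first by move/eqP; rewrite /pclass eqmodE => /asboolP.
by move=> ab; apply/eqP; rewrite /pclass eqmodE; apply/asboolP.
Qed.

Lemma pclass_repr (x : presented) : pclass (repr x) = x.
Proof. exact: reprK. Qed.

Lemma pclass_surj (x : presented) : exists a, x = pclass a.
Proof. by exists (repr x); rewrite pclass_repr. Qed.

Lemma repr_pclass a : alg_cong (repr (pclass a)) a.
Proof. by apply/pclassP; rewrite pclass_repr. Qed.

Definition padd (x y : presented) := pclass (Add (repr x) (repr y)).
Definition pmul (x y : presented) := pclass (Mul (repr x) (repr y)).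

Lemma paddE a b : padd (pclass a) (pclass b) = pclass (Add a b).
Proof. by apply/pclassP/ac_add; apply: repr_pclass. Qed.

Lemma pmulE a b : pmul (pclass a) (pclass b) = pclass (Mul a b).
Proof. by apply/pclassP/ac_mul; apply: repr_pclass. Qed.

Definition popp (x : presented) := pmul (pclass (Const (- 1))) x.
Definition pscale (r : R) (x : presented) := pmul (pclass (Const r)) x.

Local Ltac lift_terms :=
  rewrite /pscale /popp;
  repeat (let x := fresh in move=> x;
          try (have [? ->] := pclass_surj x => {x}));
  rewrite ?(paddE, pmulE); apply/pclassP.

Fact paddA : associative padd.
Proof. by lift_terms; apply: ac_addA. Qed.
Fact paddC : commutative padd.
Proof. by lift_terms; apply: ac_addC. Qed.
Fact padd0 : left_id (pclass (Const 0)) padd.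
Proof. by lift_terms; apply: ac_add0. Qed.
Fact paddN : left_inverse (pclass (Const 0)) popp padd.
Proof. by lift_terms; apply: ac_addN. Qed.

HB.instance Definition _ :=
  GRing.isZmodule.Build presented paddA paddC padd0 paddN.

Fact pmulA : associative pmul.
Proof. by lift_terms; apply: ac_mulA. Qed.
Fact pmul1 : left_id (pclass (Const 1)) pmul.
Proof. by lift_terms; apply: ac_mul1. Qed.
Fact pmulr1 : right_id (pclass (Const 1)) pmul.
Proof.
by lift_terms; apply: ac_trans (ac_mul1 _); apply/ac_sym/ac_constC.
Qed.
Fact pmulDl : left_distributive pmul padd.
Proof. by lift_terms; apply: ac_mulDl. Qed.
Fact pmulDr : right_distributive pmul padd.
Proof. by lift_terms; apply: ac_mulDr. Qed.

HB.instance Definition _ :=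
  GRing.Zmodule_isPzRing.Build presented pmulA pmul1 pmulr1 pmulDl pmulDr.

Fact pscaleA r s x : pscale r (pscale s x) = pscale (r * s) x.
Proof.
rewrite /pscale pmulA pmulE; congr pmul.
by apply/pclassP/ac_sym/ac_constM.
Qed.
Fact pscale1 : left_id 1 pscale.
Proof. exact: pmul1. Qed.
Fact pscaleDr : right_distributive pscale +%R.
Proof. by move=> r x y; apply: pmulDr. Qed.
Fact pscaleDl x : {morph pscale^~ x : r s / r + s}.
Proof.
move=> r s; rewrite /pscale -[RHS]pmulDl paddE; congr pmul.
exact/pclassP/ac_constD.
Qed.

HB.instance Definition _ := GRing.Zmodule_isLmodule.Build R presented
  pscaleA pscale1 pscaleDr pscaleDl.

Fact pscaleAl (r : R) (x y : presented) : r *: (x * y) = (r *: x) * y.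
Proof. exact: pmulA. Qed.
Fact pscaleAr (r : R) (x y : presented) : r *: (x * y) = x * (r *: y).
Proof.
have rC : pmul (pclass (Const r)) x = pmul x (pclass (Const r)).
  have [a ->] := pclass_surj x.
  by rewrite !pmulE; apply/pclassP/ac_constC.
by rewrite pscaleAl [r *: x]rC; apply/esym/pmulA.
Qed.

HB.instance Definition _ :=
  PzRing_isUAlgebra.Build R presented
    pscaleA pscale1 pscaleDr pscaleDl pscaleAl pscaleAr.

Definition pgen (x : X) : presented := pclass (Gen x).

Section UniversalProperty.
Variables (B : ualgType R) (f : X -> B).

Fixpoint alg_eval (a : alg_term) : B :=
  match a with
  | Gen x => f x
  | Const r => r *: (1 : B)
  | Add a b => alg_eval a + alg_eval b
  | Mul a b => alg_eval a * alg_eval b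
  end.

Hypothesis fP : forall a b, rel a b -> alg_eval a = alg_eval b.

Lemma alg_eval_cong a b : alg_cong a b -> alg_eval a = alg_eval b.
Proof.
elim=> {a b} //=; try by move=> *; congruence.
- by move=> *; rewrite addrA.
- by move=> *; rewrite addrC.
- by move=> *; rewrite scale0r add0r.
- by move=> a; rewrite -ualg_scalerAl mul1r scaleN1r addNr scale0r.
- by move=> *; rewrite mulrA.
- by move=> *; rewrite scale1r mul1r.
- by move=> *; rewrite mulrDl.
- by move=> *; rewrite mulrDr.
- by move=> *; rewrite scalerDl.
- by move=> r s; rewrite -ualg_scalerAl mul1r scalerA.
- by move=> r a; rewrite -ualg_scalerAl -ualg_scalerAr mul1r mulr1.
Qed.

Theorem presented_universal :
  exists! phi : presented -> B,
    [/\ scalable phi, {morph phi : x y / x + y}, phi 1 = 1,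
        {morph phi : x y / x * y} & forall x, phi (pgen x) = f x].
Proof.
pose phi (x : presented) := alg_eval (repr x).
have phiE a : phi (pclass a) = alg_eval a.
  exact/alg_eval_cong/repr_pclass.
have phiM : {morph phi : x y / x * y}.
  move=> x y; have [a ->] := pclass_surj x; have [b ->] := pclass_surj y.
  by rewrite [pclass a * _]pmulE !phiE.
exists phi; split.
  split=> //.
  - by move=> r x; rewrite [LHS](phiM (pclass (Const r)) x) phiE /=
      -ualg_scalerAl mul1r.
  - move=> x y; have [a ->] := pclass_surj x; have [b ->] := pclass_surj y.
    by rewrite [pclass a + _]paddE !phiE.
  - by rewrite [LHS](phiE (Const 1)) /= scale1r.
  - by move=> x; rewrite phiE.
move=> psi [psiZ psiD psi1 psiM psig]; apply/funext => x.
have [a ->] := pclass_surj x; rewrite phiE.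
elim: a => [y|r|a IHa b IHb|a IHa b IHb] /=.
- exact/esym/psig.
- rewrite -psi1 -psiZ; congr psi; exact: pmulr1.
- by rewrite IHa IHb -psiD [pclass a + _]paddE.
- by rewrite IHa IHb -psiM [pclass a * _]pmulE.
Qed.

End UniversalProperty.
End Presentation.

Arguments Gen {R X}.
Arguments Const {R X}.

Section Leavitt.
Variables (R : comNzRingType) (n : nat).

(* [inl i] stands for the symbol e_i and [inr i] for e_i^*. *)
Definition leavitt_symbol : Type := 'I_n + 'I_n.

Inductive leavitt_rel :
  alg_term R leavitt_symbol -> alg_term R leavitt_symbol -> Prop :=
| leavitt_orth i j :
    leavitt_rel (Mul (Gen (inr i)) (Gen (inl j))) (Const (i == j)%:R)
| leavitt_sum :
    leavitt_rel
      (\big[@Add _ _/Const 0]_(i < n) Mul (Gen (inl i)) (Gen (inr i)))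
      (Const 1).

Definition leavitt : ualgType R := presented leavitt_rel.

Definition leavitt_e (i : 'I_n) : leavitt := pgen leavitt_rel (inl i).
Definition leavitt_es (i : 'I_n) : leavitt := pgen leavitt_rel (inr i).

Lemma leavitt_es_e i j : leavitt_es i * leavitt_e j = (i == j)%:R.
Proof.
transitivity (pclass leavitt_rel (Const (i == j)%:R)); last by case: (i == j).
by rewrite [LHS]pmulE; apply/pclassP/ac_rel/leavitt_orth.
Qed.

Lemma leavitt_sum_e_es : \sum_(i < n) leavitt_e i * leavitt_es i = 1.
Proof.
transitivity (pclass leavitt_rel
    (\big[@Add _ _/Const 0]_(i < n) Mul (Gen (inl i)) (Gen (inr i)))).
  apply: (big_ind2 (fun (x : leavitt) a => x = pclass leavitt_rel a)) => //.
  - by move=> _ a _ b -> ->; apply: paddE.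
  - by move=> i _; apply: pmulE.
exact/pclassP/ac_rel/leavitt_sum.
Qed.

Theorem leavitt_universal (B : ualgType R) (e es : 'I_n -> B) :
  (forall i j, es i * e j = (i == j)%:R) -> \sum_(i < n) e i * es i = 1 ->
  exists! phi : leavitt -> B,
    [/\ scalable phi, {morph phi : x y / x + y}, phi 1 = 1,
        {morph phi : x y / x * y} &
        forall i, phi (leavitt_e i) = e i /\ phi (leavitt_es i) = es i].
Proof.
move=> orth sum1.
pose f (x : leavitt_symbol) := match x with inl i => e i | inr i => es i end.
have [|phi [[phiZ phiD phi1 phiM phif] phi_uniq]] :=
    @presented_universal _ _ leavitt_rel B f.
  move=> _ _ [i j|] /=; first by rewrite orth; case: (i == j);
    rewrite ?scale1r ?scale0r.
  rewrite scale1r -sum1.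
  apply: (big_ind2 (fun a (y : B) => alg_eval f a = y)) => //=.
  - by rewrite scale0r.
  - by move=> a _ b _ <- <-.
exists phi; split.
  by split=> // i; split; [apply: (phif (inl i)) | apply: (phif (inr i))].
move=> psi [psiZ psiD psi1 psiM psie]; apply: phi_uniq.
by split=> // -[] i; case: (psie i).
Qed.

(* e_{i_1} ... e_{i_k} e_{i_k}^* ... e_{i_1}^* for the word [:: i_1; ..; i_k] *)
Definition leavitt_proj (w : seq 'I_n) : leavitt :=
  (\prod_(i <- w) leavitt_e i) * \prod_(i <- rev w) leavitt_es i.

(* The empty word contributes only the unit. *)
Definition leavitt_diag : leavitt -> Prop :=
  generated_subalgebra (fun x => exists w, x = leavitt_proj w).

End Leavitt.

Section Tensor.
Variables (R : comNzRingType) (k : nat) (A : 'I_k -> ualgType R).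

Definition entries := forall i : 'I_k, A i.

Inductive tensor_term : Type :=
| Pure of entries
| TZero
| TAdd of tensor_term & tensor_term
| TScale of R & tensor_term.

HB.instance Definition _ := gen_eqMixin tensor_term.
HB.instance Definition _ := gen_choiceMixin tensor_term.

(* [dfwith a x] is the family [a] with its [i]-th entry replaced by [x : A i]. *)
Inductive tensor_cong : tensor_term -> tensor_term -> Prop :=
| tc_refl u : tensor_cong u u
| tc_sym u v : tensor_cong u v -> tensor_cong v u
| tc_trans v u w : tensor_cong u v -> tensor_cong v w -> tensor_cong u w
| tc_add u u' v v' : tensor_cong u u' -> tensor_cong v v' ->
    tensor_cong (TAdd u v) (TAdd u' v')
| tc_scale r u u' : tensor_cong u u' -> tensor_cong (TScale r u) (TScale r u')
| tc_addA u v w : tensor_cong (TAdd u (TAdd v w)) (TAdd (TAdd u v) w)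
| tc_addC u v : tensor_cong (TAdd u v) (TAdd v u)
| tc_add0 u : tensor_cong (TAdd TZero u) u
| tc_addN u : tensor_cong (TAdd (TScale (- 1) u) u) TZero
| tc_scaleA r s u : tensor_cong (TScale r (TScale s u)) (TScale (r * s) u)
| tc_scale1 u : tensor_cong (TScale 1 u) u
| tc_scaleDr r u v :
    tensor_cong (TScale r (TAdd u v)) (TAdd (TScale r u) (TScale r v))
| tc_scaleDl r s u :
    tensor_cong (TScale (r + s) u) (TAdd (TScale r u) (TScale s u))
| tc_pureD (a : entries) i (x y : A i) :
    tensor_cong (Pure (dfwith a (x + y)))
                (TAdd (Pure (dfwith a x)) (Pure (dfwith a y)))
| tc_pureZ (a : entries) i r (x : A i) :
    tensor_cong (Pure (dfwith a (r *: x))) (TScale r (Pure (dfwith a x))).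

Definition tensor_congb (u v : tensor_term) : bool := `[< tensor_cong u v >].

Lemma tensor_congb_refl : reflexive tensor_congb.
Proof. by move=> u; apply/asboolP/tc_refl. Qed.

Lemma tensor_congb_sym : symmetric tensor_congb.
Proof. by move=> u v; apply/asboolP/asboolP; apply: tc_sym. Qed.

Lemma tensor_congb_trans : transitive tensor_congb.
Proof.
by move=> v u w /asboolP uv /asboolP vw; apply/asboolP/(tc_trans uv vw).
Qed.

Canonical tensor_cong_equiv :=
  EquivRel tensor_congb tensor_congb_refl tensor_congb_sym tensor_congb_trans.

Definition tensor_type := {eq_quot tensor_cong_equiv}.

HB.instance Definition _ := Choice.on tensor_type.

Definition tclass (u : tensor_term) : tensor_type := \pi u.

Lemma tclassP u v : tclass u = tclass v <-> tensor_cong u v.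
Proof.
split; first by move/eqP; rewrite /tclass eqmodE => /asboolP.
by move=> uv; apply/eqP; rewrite /tclass eqmodE; apply/asboolP.
Qed.

Lemma tclass_repr (x : tensor_type) : tclass (repr x) = x.
Proof. exact: reprK. Qed.

Lemma tclass_surj (x : tensor_type) : exists u, x = tclass u.
Proof. by exists (repr x); rewrite tclass_repr. Qed.

Lemma repr_tclass u : tensor_cong (repr (tclass u)) u.
Proof. by apply/tclassP; rewrite tclass_repr. Qed.

Definition tadd (x y : tensor_type) := tclass (TAdd (repr x) (repr y)).
Definition tscale r (x : tensor_type) := tclass (TScale r (repr x)).
Definition topp (x : tensor_type) := tscale (- 1) x.

Lemma taddE u v : tadd (tclass u) (tclass v) = tclass (TAdd u v).
Proof. by apply/tclassP/tc_add; apply: repr_tclass. Qed.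

Lemma tscaleE r u : tscale r (tclass u) = tclass (TScale r u).
Proof. by apply/tclassP/tc_scale; apply: repr_tclass. Qed.

Fact taddA : associative tadd.
Proof.
move=> x y z; have [u ->] := tclass_surj x; have [v ->] := tclass_surj y.
by have [w ->] := tclass_surj z; rewrite !taddE; apply/tclassP/tc_addA.
Qed.
Fact taddC : commutative tadd.
Proof.
move=> x y; have [u ->] := tclass_surj x; have [v ->] := tclass_surj y.
by rewrite !taddE; apply/tclassP/tc_addC.
Qed.
Fact tadd0 : left_id (tclass TZero) tadd.
Proof.
by move=> x; have [u ->] := tclass_surj x; rewrite taddE; apply/tclassP/tc_add0.
Qed.
Fact taddN : left_inverse (tclass TZero) topp tadd.
Proof.
move=> x; have [u ->] := tclass_surj x; rewrite /topp tscaleE taddE.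
exact/tclassP/tc_addN.
Qed.

HB.instance Definition _ :=
  GRing.isZmodule.Build tensor_type taddA taddC tadd0 taddN.

Fact tscaleA r s x : tscale r (tscale s x) = tscale (r * s) x.
Proof.
have [u ->] := tclass_surj x; rewrite !tscaleE; exact/tclassP/tc_scaleA.
Qed.
Fact tscale1 : left_id 1 tscale.
Proof.
move=> x; have [u ->] := tclass_surj x; rewrite tscaleE.
exact/tclassP/tc_scale1.
Qed.
Fact tscaleDr : right_distributive tscale +%R.
Proof.
move=> r x y; have [u ->] := tclass_surj x; have [v ->] := tclass_surj y.
rewrite [tclass u + _]taddE !tscaleE [RHS]taddE; exact/tclassP/tc_scaleDr.
Qed.
Fact tscaleDl x : {morph tscale^~ x : r s / r + s}.
Proof.
move=> r s /=; have [u ->] := tclass_surj x; rewrite !tscaleE [RHS]taddE.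
exact/tclassP/tc_scaleDl.
Qed.

HB.instance Definition _ := GRing.Zmodule_isLmodule.Build R tensor_type
  tscaleA tscale1 tscaleDr tscaleDl.

Definition pure (a : entries) : tensor_type := tclass (Pure a).

Lemma pureD (a : entries) i (x y : A i) :
  pure (dfwith a (x + y)) = pure (dfwith a x) + pure (dfwith a y).
Proof. rewrite [RHS]taddE; exact/tclassP/tc_pureD. Qed.

Lemma pureZ (a : entries) i r (x : A i) :
  pure (dfwith a (r *: x)) = r *: pure (dfwith a x).
Proof. rewrite [RHS]tscaleE; exact/tclassP/tc_pureZ. Qed.

Lemma tensor_ind (P : tensor_type -> Prop) :
  (forall a, P (pure a)) -> P 0 ->
  (forall x y, P x -> P y -> P (x + y)) -> (forall r x, P x -> P (r *: x)) ->
  forall x, P x.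
Proof.
move=> Ppure P0 PD PZ x; have [u ->] := tclass_surj x.
elim: u => [a||u IHu v IHv|r u IHu].
- exact: Ppure.
- exact: P0.
- by rewrite -taddE; apply: PD.
- by rewrite -tscaleE; apply: PZ.
Qed.

Section UniversalProperty.
Variables (V : lmodType R) (f : entries -> V).

Definition multilinear : Prop :=
  (forall (a : entries) i (x y : A i),
     f (dfwith a (x + y)) = f (dfwith a x) + f (dfwith a y)) /\
  (forall (a : entries) i r (x : A i),
     f (dfwith a (r *: x)) = r *: f (dfwith a x)).

Fixpoint tensor_eval (u : tensor_term) : V :=
  match u with
  | Pure a => f a
  | TZero => 0
  | TAdd u v => tensor_eval u + tensor_eval v
  | TScale r u => r *: tensor_eval u
  end.

Hypothesis fP : multilinear.

Lemma tensor_eval_cong u v :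
  tensor_cong u v -> tensor_eval u = tensor_eval v.
Proof.
elim=> {u v} //=; try by move=> *; congruence.
- by move=> *; rewrite addrA.
- by move=> *; rewrite addrC.
- by move=> *; rewrite add0r.
- by move=> *; rewrite scaleN1r addNr.
- by move=> *; rewrite scalerA.
- by move=> *; rewrite scale1r.
- by move=> *; rewrite scalerDr.
- by move=> *; rewrite scalerDl.
- by move=> *; rewrite fP.1.
- by move=> *; rewrite fP.2.
Qed.

Definition tensor_lift (x : tensor_type) : V := tensor_eval (repr x).

Lemma tensor_liftE u : tensor_lift (tclass u) = tensor_eval u.
Proof. exact/tensor_eval_cong/repr_tclass. Qed.

Lemma tensor_lift_pure a : tensor_lift (pure a) = f a.
Proof. exact: tensor_liftE. Qed.

Lemma tensor_liftD : {morph tensor_lift : x y / x + y}.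
Proof.
move=> x y; have [u ->] := tclass_surj x; have [v ->] := tclass_surj y.
by rewrite [tclass u + _]taddE !tensor_liftE.
Qed.

Lemma tensor_liftZ : scalable tensor_lift.
Proof.
move=> r x; have [u ->] := tclass_surj x.
by rewrite [r *: _]tscaleE !tensor_liftE.
Qed.

Lemma tensor_lift0 : tensor_lift 0 = 0.
Proof. exact: (tensor_liftE TZero). Qed.

Lemma tensor_lift_uniq (psi : tensor_type -> V) :
  {morph psi : x y / x + y} -> scalable psi ->
  (forall a, psi (pure a) = f a) -> psi =1 tensor_lift.
Proof.
move=> psiD psiZ psip; elim/tensor_ind => [a||x y IHx IHy|r x IHx].
- by rewrite psip tensor_lift_pure.
- by rewrite -(scale0r 0) psiZ tensor_liftZ !scale0r.
- by rewrite psiD IHx IHy tensor_liftD.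
- by rewrite psiZ IHx tensor_liftZ.
Qed.

End UniversalProperty.

(* The multiplication is the bilinear map determined by
   [pure a * pure b = pure (fun i => a i * b i)]. *)

Definition mulf (a b : entries) : entries := fun i => a i * b i.

Lemma mulf_dfwithl (a b : entries) i (x : A i) :
  mulf (dfwith a x) b = dfwith (mulf a b) (x * b i).
Proof.
apply: functional_extensionality_dep => j; rewrite /mulf.
by case: (eqVneq i j) => [<-|ij]; rewrite ?dfwith_in ?dfwith_out.
Qed.

Lemma mulf_dfwithr (a b : entries) i (x : A i) :
  mulf a (dfwith b x) = dfwith (mulf a b) (a i * x).
Proof.
apply: functional_extensionality_dep => j; rewrite /mulf.
by case: (eqVneq i j) => [<-|ij]; rewrite ?dfwith_in ?dfwith_out.
Qed.

Definition pure_mull (a : entries) : tensor_type -> tensor_type :=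
  tensor_lift (fun b => pure (mulf a b)).

Fact pure_mull_multilinear a : multilinear (fun b => pure (mulf a b)).
Proof.
by split=> *; rewrite !mulf_dfwithr ?mulrDr ?pureD // -ualg_scalerAr pureZ.
Qed.

Definition tmul (x y : tensor_type) : tensor_type :=
  tensor_lift (fun a => pure_mull a y) x.

Fact tmul_multilinear y : multilinear (fun a => pure_mull a y).
Proof.
split=> a i.
- move=> x x'; move: y; apply: tensor_ind => [b||y z IHy IHz|r y IHy].
  + rewrite /pure_mull !tensor_lift_pure; try exact: pure_mull_multilinear.
    by rewrite !mulf_dfwithl mulrDl pureD.
  + by rewrite /pure_mull !tensor_lift0 ?addr0 //; exact: pure_mull_multilinear.
  + rewrite /pure_mull in IHy IHz *.
    rewrite !tensor_liftD; try exact: pure_mull_multilinear.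
    by rewrite IHy IHz addrACA.
  + rewrite /pure_mull in IHy *.
    rewrite !tensor_liftZ; try exact: pure_mull_multilinear.
    by rewrite IHy scalerDr.
- move=> s x; move: y; apply: tensor_ind => [b||y z IHy IHz|r y IHy].
  + rewrite /pure_mull !tensor_lift_pure; try exact: pure_mull_multilinear.
    by rewrite !mulf_dfwithl -ualg_scalerAl pureZ.
  + rewrite /pure_mull !tensor_lift0 ?scaler0 //; exact: pure_mull_multilinear.
  + rewrite /pure_mull in IHy IHz *.
    rewrite !tensor_liftD; try exact: pure_mull_multilinear.
    by rewrite IHy IHz scalerDr.
  + rewrite /pure_mull in IHy *.
    rewrite !tensor_liftZ; try exact: pure_mull_multilinear.
    by rewrite IHy !scalerA mulrC.
Qed.

Fact tmul_pure a b : tmul (pure a) (pure b) = pure (mulf a b).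
Proof.
rewrite /tmul tensor_lift_pure; last exact: tmul_multilinear.
by rewrite /pure_mull tensor_lift_pure //; apply: pure_mull_multilinear.
Qed.

Fact tmulDl : left_distributive tmul +%R.
Proof. by move=> x y z; apply/tensor_liftD/tmul_multilinear. Qed.

Fact tmulZl r x y : tmul (r *: x) y = r *: tmul x y.
Proof. exact/tensor_liftZ/tmul_multilinear. Qed.

Fact tmul0l y : tmul 0 y = 0.
Proof. exact/tensor_lift0/tmul_multilinear. Qed.

Fact tmul_purel a y : tmul (pure a) y = pure_mull a y.
Proof. exact/tensor_lift_pure/tmul_multilinear. Qed.

Fact tmulDr : right_distributive tmul +%R.
Proof.
move=> x y z; move: x; apply: tensor_ind => [a||u v IHu IHv|r u IHu].
- rewrite !tmul_purel; exact/tensor_liftD/pure_mull_multilinear.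
- by rewrite !tmul0l addr0.
- by rewrite !tmulDl IHu IHv addrACA.
- by rewrite !tmulZl IHu scalerDr.
Qed.

Fact tmulZr r x y : tmul x (r *: y) = r *: tmul x y.
Proof.
move: x; apply: tensor_ind => [a||u v IHu IHv|s u IHu].
- rewrite !tmul_purel; exact/tensor_liftZ/pure_mull_multilinear.
- by rewrite !tmul0l scaler0.
- by rewrite !tmulDl IHu IHv scalerDr.
- by rewrite !tmulZl IHu !scalerA mulrC.
Qed.

Fact tmul0r x : tmul x 0 = 0.
Proof. by rewrite -(scale0r 0) tmulZr !scale0r. Qed.

Fact tmulA : associative tmul.
Proof.
move=> x y z; move: x; apply: tensor_ind => [a||u v IHu IHv|r u IHu].
- move: y; apply: tensor_ind => [b||u v IHu IHv|r u IHu].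
  + move: z; apply: tensor_ind => [c||u v IHu IHv|r u IHu].
    * rewrite !tmul_pure; congr pure; apply: functional_extensionality_dep => i.
      by rewrite /mulf mulrA.
    * by rewrite !tmul0r.
    * by rewrite !tmulDr IHu IHv.
    * by rewrite !tmulZr IHu.
  + by rewrite tmul0r !tmul0l tmul0r.
  + by rewrite tmulDr !tmulDl tmulDr IHu IHv.
  + by rewrite tmulZr !tmulZl tmulZr IHu.
- by rewrite !tmul0l.
- by rewrite !tmulDl IHu IHv.
- by rewrite !tmulZl IHu.
Qed.

Definition tone : tensor_type := pure (fun i => 1).

Fact tmul1 : left_id tone tmul.
Proof.
apply: tensor_ind => [a||u v IHu IHv|r u IHu].
- rewrite tmul_pure; congr pure; apply: functional_extensionality_dep => i.
  by rewrite /mulf mul1r.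
- exact: tmul0r.
- by rewrite tmulDr IHu IHv.
- by rewrite tmulZr IHu.
Qed.

Fact tmulr1 : right_id tone tmul.
Proof.
apply: tensor_ind => [a||u v IHu IHv|r u IHu].
- rewrite tmul_pure; congr pure; apply: functional_extensionality_dep => i.
  by rewrite /mulf mulr1.
- exact: tmul0l.
- by rewrite tmulDl IHu IHv.
- by rewrite tmulZl IHu.
Qed.

HB.instance Definition _ :=
  GRing.Zmodule_isPzRing.Build tensor_type tmulA tmul1 tmulr1 tmulDl tmulDr.

HB.instance Definition _ := PzRing_isUAlgebra.Build R tensor_type
  tscaleA tscale1 tscaleDr tscaleDl
  (fun r x y => esym (tmulZl r x y)) (fun r x y => esym (tmulZr r x y)).

Definition tensor : ualgType R := tensor_type.

Definition tensor_sub (D : forall i, A i -> Prop) : tensor -> Prop :=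
  linear_span (fun x : tensor =>
    exists a : entries, (forall i, D i (a i)) /\ x = pure a).

End Tensor.

Definition leavitt_tensor (R : comNzRingType) (k : nat) (n : k.-tuple nat) :
    ualgType R :=
  tensor (fun i => leavitt R (tnth n i)).

Definition diag_tensor (R : comNzRingType) (k : nat) (n : k.-tuple nat) :
    leavitt_tensor R n -> Prop :=
  tensor_sub (fun i => @leavitt_diag R (tnth n i)).

(* Main.v *)
(* The isomorphism carries the diagonal of the first algebra onto that of the
   second, because diagonals are maximal commutative. As R is indecomposable,
   characters of a diagonal are evaluations at points of the product of the
   spaces of infinite words, so we get a homeomorphism h of these products. The
   image of e_u e_v^* normalizes the diagonal, and evaluating its matrix at
   aperiodic points (which are dense) shows that h conjugates the pseudogroup
   generated by prefix replacements onto the corresponding pseudogroup.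

   Fix the point x = (0^oo, ..., 0^oo). The germ at x prepending 0 in all
   coordinates but the i-th fixes, near x, exactly the i-th coordinate slice
   through x. Its conjugate by h again acts by prefix replacement in each
   coordinate, so its fixed points near h(x) form a product of coordinate
   slices; only one coordinate can occur, since a germ acting on a single
   slice and fixing a point is locally trivial or fixes that point only. Thus h
   maps the i-th slice at x locally onto the sigma(i)-th slice at h(x), and sigma
   is injective. Counting cylinders modulo m - 1 is an invariant of clopen sets
   of words over m letters under prefix replacement; comparing it along h gives
   that m_sigma(i) - 1 divides n_i - 1. Applying this to the inverse as well, both
   tuples agree up to permutation. *)
Require Import Defs.
From HB Require Import structures.
From mathcomp Require Import all_boot all_algebra perm.
From mathcomp Require Import boolp functions zify.

Set Implicit Arguments.
Unset Strict Implicit.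
Unset Printing Implicit Defensive.

Import GRing.Theory.
Local Open Scope ring_scope.

(** * Infinite words and prefix replacement *)

Section InfiniteSequences.
Local Open Scope nat_scope.
Variable T : Type.
Implicit Types (w : seq T) (t : nat -> T).

(** The default letter [t 0] is never returned, as [nth] is only read below [size w]; it spares
    assuming an inhabitant of [T]. *)
Definition scat w t : nat -> T :=
  fun n => if n < size w then nth (t 0) w n else t (n - size w).

Definition sdrop N t : nat -> T := fun n => t (N + n).

Lemma scat_nil t : scat [::] t = t.
Proof. by apply/funext => n; rewrite /scat /= subn0. Qed.

Lemma scat_cat w w' t : scat (w ++ w') t = scat w (scat w' t).
Proof.
apply/funext => n; rewrite /scat size_cat nth_cat.
case: (ltnP n (size w)) => [nw|wn].
  by rewrite ltn_addr //; apply: set_nth_default.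
by rewrite ltn_subLR // subnDA.
Qed.

Lemma scat_cons c w t : scat (c :: w) t = scat [:: c] (scat w t).
Proof. by rewrite -scat_cat. Qed.

Lemma scat_rcons w c t : scat (rcons w c) t = scat w (scat [:: c] t).
Proof. by rewrite -scat_cat cats1. Qed.

Lemma sdrop_scat w t : sdrop (size w) (scat w t) = t.
Proof.
by apply/funext => n; rewrite /sdrop /scat ltnNge leq_addr /= addKn.
Qed.

Lemma sdropD M N t : sdrop N (sdrop M t) = sdrop (M + N) t.
Proof. by apply/funext => n; rewrite /sdrop addnA. Qed.

Lemma sdrop0 t : sdrop 0 t = t.
Proof. by apply/funext => n. Qed.

Lemma mkseq_scat w t : mkseq (scat w t) (size w) = w.
Proof.
apply: (@eq_from_nth _ (t 0)); rewrite size_mkseq // => n nw.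
by rewrite nth_mkseq // /scat nw.
Qed.

Lemma mkseq_scat_size N w t : size w = N -> mkseq (scat w t) N = w.
Proof. by move=> <-; apply: mkseq_scat. Qed.

Lemma scat_mkseq N t : scat (mkseq t N) (sdrop N t) = t.
Proof.
apply/funext => n; rewrite /scat size_mkseq; case: ltnP => nN.
  by rewrite nth_mkseq.
by rewrite /sdrop subnKC.
Qed.

Lemma mkseq_take N M t : N <= M -> mkseq t N = take N (mkseq t M).
Proof. by move=> NM; rewrite /mkseq -map_take take_iota (minn_idPl NM). Qed.

Lemma mkseq_scat_le N w t t' : N <= size w ->
  mkseq (scat w t) N = mkseq (scat w t') N.
Proof. by move=> Nw; rewrite !(mkseq_take _ Nw) !mkseq_scat. Qed.

Lemma mkseq_le N M t t' : N <= M ->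
  mkseq t M = mkseq t' M -> mkseq t N = mkseq t' N.
Proof. by move=> NM e; rewrite !(mkseq_take _ NM) e. Qed.

Lemma eq_mkseqP N t t' :
  mkseq t N = mkseq t' N <-> (forall n, n < N -> t n = t' n).
Proof.
split=> [e n nN|e].
  by rewrite -(nth_mkseq (t 0) t nN) e nth_mkseq.
apply: (@eq_from_nth _ (t 0)); rewrite !size_mkseq // => n nN.
by rewrite !nth_mkseq // e.
Qed.

Lemma mkseq_inj t t' : (forall N, mkseq t N = mkseq t' N) -> t = t'.
Proof. by move=> e; apply/funext => n; apply: (eq_mkseqP n.+1 t t').1. Qed.

Lemma mkseqD t N M : mkseq t (N + M) = mkseq t N ++ mkseq (sdrop N t) M.
Proof.
rewrite /mkseq iotaD map_cat; congr (_ ++ _).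
by rewrite add0n -[X in iota X M]addn0 iotaDl -map_comp.
Qed.

Lemma mkseq_scatD w t N : mkseq (scat w t) (size w + N) = w ++ mkseq t N.
Proof. by rewrite mkseqD mkseq_scat sdrop_scat. Qed.

Lemma scat_injl w w' t t' : size w = size w' -> scat w t = scat w' t' -> w = w'.
Proof. by move=> sz e; rewrite -(mkseq_scat w t) e sz mkseq_scat. Qed.

Lemma scat_injr w t t' : scat w t = scat w t' -> t = t'.
Proof. by move=> e; rewrite -(sdrop_scat w t) e sdrop_scat. Qed.

Lemma scat_prefix w w' t t' : size w <= size w' -> scat w t = scat w' t' ->
  exists2 r, w' = w ++ r & t = scat r t'.
Proof.
move=> sz e; exists (drop (size w) w').
  rewrite -{1}(cat_take_drop (size w) w'); congr (_ ++ _).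
  by rewrite -{1}(mkseq_scat w' t') -(mkseq_take _ sz) -e mkseq_scat.
apply: (@scat_injr w); rewrite e -scat_cat; congr scat.
rewrite -{1}(cat_take_drop (size w) w'); congr (_ ++ _).
by rewrite -{1}(mkseq_scat w' t') -(mkseq_take _ sz) -e mkseq_scat.
Qed.

(** Strong induction on positions: a letter beyond [r] is copied from an earlier position, so [r]
    repeated forever is the only solution. *)
Lemma scat_fix_uniq r t t' :
  0 < size r -> t = scat r t -> t' = scat r t' -> t = t'.
Proof.
move=> r0 et et'; apply/funext; elim/ltn_ind => n IH.
rewrite et et' /scat; case: ltnP => nr; first exact: set_nth_default.
by apply: IH; rewrite ltn_subrL r0 (leq_trans r0).
Qed.

(** Cancelling the shorter word leaves an equation [t = scat r t] with [r] nonempty, and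
    [scat_fix_uniq] applies. *)
Lemma scat_eq_uniq a b t t' : size a != size b ->
  scat a t = scat b t -> scat a t' = scat b t' -> t = t'.
Proof.
wlog lt_ab : a b / size a < size b.
  move=> wl ne e e'; have [lt|lt] := orP (etrans (esym (neq_ltn _ _)) ne).
    exact: (wl a b).
  by apply: (wl b a) => //; rewrite eq_sym.
move=> _ e e'; have [r bE tE] := scat_prefix (ltnW lt_ab) e.
have t'E : t' = scat r t'.
  by apply: (@scat_injr a); rewrite e' bE scat_cat.
apply: (scat_fix_uniq _ tE t'E).
by move: lt_ab; rewrite bE size_cat; lia.
Qed.

(** This excludes eventual periodicity. Over such a tail [t], the word [w] can be recovered from
    [scat w t]. *)
Definition aperiodic t := forall p p', p < p' -> sdrop p t <> sdrop p' t.

Lemma aperiodic_scat w t : aperiodic t -> aperiodic (scat w t).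
Proof.
move=> tP p p' pp' e; apply: (tP p p' pp').
by rewrite -(sdrop_scat w t) !sdropD (addnC _ p) (addnC _ p') -!sdropD e.
Qed.

Lemma aperiodic_scat_inj w w' t : aperiodic t -> scat w t = scat w' t -> w = w'.
Proof.
move=> tP e.
wlog le : w w' e / size w <= size w'.
  by move=> wl; case: (leqP (size w) (size w')) => [|/ltnW] le;
    [apply: wl | apply/esym/wl].
have [r w'E tE] := scat_prefix le e.
case: r => [|c r] in w'E tE *; first by rewrite w'E cats0.
have := tP 0 (size (c :: r)) isT; rewrite sdrop0 {2}tE.
by rewrite sdrop_scat.
Qed.

End InfiniteSequences.

Lemma aperiodic_exists (T : Type) (a b : T) : a <> b -> exists t : nat -> T, aperiodic t.
Proof.
move=> ab.
(* The letter [a] marks the powers of two. If two shifts agreed, then [2 ^ j + (p' - p)] would be a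
   power of two for large [j], though it lies strictly between [2 ^ j] and [2 ^ j.+1]. *)
pose t n := if `[< exists j, n = (2 ^ j)%N >] then a else b.
exists t => p p' pp' e.
have [j pj] : exists j, (p' < 2 ^ j)%N by exists p'; apply: ltn_expl.
have := congr1 (fun f => f (2 ^ j - p)%N) e; rewrite /sdrop /t subnKC; last lia.
rewrite asboolT; last by exists j.
case: asboolP => // -[i ei] _.
have : (2 ^ j < 2 ^ i < 2 ^ j.+1)%N by rewrite -ei expnS; apply/andP; lia.
by rewrite !ltn_exp2l //; lia.
Qed.

(** * Points of a product of spaces of infinite words *)

Section Points.
Variables (k : nat) (q : 'I_k -> nat).

Definition point := forall i : 'I_k, nat -> 'I_(q i).
Definition mword := forall i : 'I_k, seq 'I_(q i).

Implicit Types (x y t : point) (u v w : mword).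

Definition mcat u x : point := fun i => scat (u i) (x i).
Definition mdrop u x : point := fun i => sdrop (size (u i)) (x i).
Definition mpre N x : mword := fun i => mkseq (x i) N.
Definition mnil : mword := fun i => [::].
Definition mcatw u v : mword := fun i => u i ++ v i.

Definition mprefix u x : bool := [forall i, mkseq (x i) (size (u i)) == u i].

Lemma mprefixP u x : reflect (forall i, mkseq (x i) (size (u i)) = u i) (mprefix u x).
Proof. exact: 'forall_eqP. Qed.

Lemma pointP x y : (forall i, x i = y i) -> x = y.
Proof. exact: functional_extensionality_dep. Qed.

Lemma mwordP u v : (forall i, u i = v i) -> u = v.
Proof. exact: functional_extensionality_dep. Qed.

Lemma mcat_catw u v x : mcat (mcatw u v) x = mcat u (mcat v x).
Proof. by apply: pointP => i; rewrite /mcat scat_cat. Qed.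

Lemma mdrop_cat u x : mdrop u (mcat u x) = x.
Proof. by apply: pointP => i; rewrite /mdrop /mcat sdrop_scat. Qed.

Lemma mcat_drop u x : mprefix u x -> mcat u (mdrop u x) = x.
Proof.
move=> /mprefixP ux; apply: pointP => i.
by rewrite /mcat /mdrop -{1}(ux i) scat_mkseq.
Qed.

Lemma mprefix_cat u x : mprefix u (mcat u x).
Proof. by apply/mprefixP => i; rewrite mkseq_scat. Qed.

Lemma mprefix_pre N x : mprefix (mpre N x) x.
Proof. by apply/mprefixP => i; rewrite size_mkseq. Qed.

Lemma mcat_pre N x : mcat (mpre N x) (mdrop (mpre N x) x) = x.
Proof. exact/mcat_drop/mprefix_pre. Qed.

Lemma mpre_cat N u x : (forall i, size (u i) = N) -> mpre N (mcat u x) = u.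
Proof.
by move=> uN; apply: mwordP => i; rewrite /mpre /mcat -(uN i) mkseq_scat.
Qed.

Lemma mpre_le N M x y : (N <= M)%N -> mpre M x = mpre M y -> mpre N x = mpre N y.
Proof.
move=> NM e; apply: mwordP => i.
apply: (mkseq_le NM); exact: (congr1 (fun f : mword => f i) e).
Qed.

Lemma mpre_mcat N u x y : mpre N x = mpre N y -> mpre N (mcat u x) = mpre N (mcat u y).
Proof.
move=> e; apply: mwordP => i; apply/eq_mkseqP => p pN; rewrite /mcat /scat.
case: ltnP => pu; first exact: set_nth_default.
have := congr1 (fun f : mword => f i) e; rewrite /mpre => /eq_mkseqP; apply.
exact: leq_ltn_trans (leq_subr _ _) pN.
Qed.

Lemma mpre_mdrop N M u x y : (forall i, size (u i) <= M)%N ->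
  mpre (M + N) x = mpre (M + N) y -> mpre N (mdrop u x) = mpre N (mdrop u y).
Proof.
move=> uM e; apply: mwordP => i; apply/eq_mkseqP => p pN; rewrite /mdrop /sdrop.
have := congr1 (fun f : mword => f i) e; rewrite /mpre => /eq_mkseqP; apply.
by rewrite -addnS leq_add.
Qed.

Lemma mpreD N M x : mpre (N + M) x = mcatw (mpre N x) (mpre M (mdrop (mpre N x) x)).
Proof. by apply: mwordP => i; rewrite /mpre /mcatw /mdrop size_mkseq mkseqD. Qed.

Lemma mpre_prefix u N x y : (forall i, (size (u i) <= N)%N) ->
  mpre N x = mpre N y -> mprefix u x = mprefix u y.
Proof.
move=> uN e; apply: eq_forallb => i; congr (_ == _).
apply: mkseq_le (uN i) _; exact: (congr1 (fun f : mword => f i) e).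
Qed.

Lemma mpre_inj x y : (forall N, mpre N x = mpre N y) -> x = y.
Proof.
move=> e; apply: pointP => i; apply: mkseq_inj => N.
exact: (congr1 (fun f : mword => f i) (e N)).
Qed.

Lemma mword_bound u : exists N, forall i, (size (u i) <= N)%N.
Proof. by exists (\max_i size (u i)) => i; apply: leq_bigmax. Qed.

Definition maperiodic x := forall i, aperiodic (x i).

Lemma maperiodic_cat u x : maperiodic x -> maperiodic (mcat u x).
Proof. by move=> xP i; apply: aperiodic_scat. Qed.

Lemma maperiodic_inj u v x : maperiodic x -> mcat u x = mcat v x -> u = v.
Proof.
move=> xP e; apply: mwordP => i; apply: aperiodic_scat_inj (xP i) _.
exact: (congr1 (fun f : point => f i) e).
Qed.

Lemma maperiodic_exists : (forall i, 1 < q i)%N -> exists x, maperiodic x.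
Proof.
move=> q2.
have [x xP] : exists x : point, forall i, aperiodic (x i).
  apply: (fin_all_exists (P := fun i => @aperiodic 'I_(q i))) => i.
  apply: (@aperiodic_exists _ (Ordinal (ltnW (q2 i))) (Ordinal (q2 i))).
  by move/(congr1 val).
by exists x.
Qed.

End Points.

(** * Counting cylinders *)

Section CylinderCounting.
Local Open Scope nat_scope.
Variables (m : nat) (c0 : 'I_m).
Implicit Types (V W : (nat -> 'I_m) -> nat) (w : seq 'I_m) (s : nat -> 'I_m).

Definition locally_constant V L :=
  forall s s', mkseq s L = mkseq s' L -> V s = V s'.

(** Each word of length [L] contributes the value of [V] at its continuation by [c0]. Once [V] is
    locally constant at depth [L], the choice of [c0] is immaterial. *)
Fixpoint count_words V L :=
  if L is L'.+1 then \sum_(c < m) count_words (fun s => V (scat [:: c] s)) L'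
  else V (fun=> c0).

(** For the indicator of a clopen set this is its class modulo [m.-1], every cylinder having class
    1. The depth is existential because refining does not change the class. *)
Definition count_value V a :=
  exists2 L, locally_constant V L & count_words V L = a %[mod m.-1].

Lemma locally_constant_le V L L' :
  L <= L' -> locally_constant V L -> locally_constant V L'.
Proof. by move=> LL' VL s s' e; apply/VL/(mkseq_le LL'). Qed.

Lemma locally_constant_cons V L c :
  locally_constant V L.+1 -> locally_constant (fun s => V (scat [:: c] s)) L.
Proof. by move=> VL s s' e; apply: VL; rewrite !(mkseq_scatD [:: c]) e. Qed.

Lemma count_wordsS V L : locally_constant V L ->
  count_words V L.+1 = m * count_words V L.
Proof.
elim: L V => [|L IH] V VL /=.
  rewrite (eq_bigr (fun=> V (fun=> c0))); last by move=> c _; apply: VL.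
  by rewrite sum_nat_const card_ord.
rewrite big_distrr /=; apply: eq_bigr => c _.
exact/IH/locally_constant_cons.
Qed.

(** Each further letter multiplies the count by [m], which is 1 modulo [m.-1]. *)
Lemma count_wordsD V L d : locally_constant V L ->
  count_words V (L + d) = count_words V L %[mod m.-1].
Proof.
move=> VL; elim: d => [|d IH]; first by rewrite addn0.
rewrite addnS count_wordsS; last exact: locally_constant_le (leq_addr _ _) VL.
have m0 : 0 < m by apply: leq_ltn_trans (ltn_ord c0).
by rewrite -[X in X * _](prednK m0) mulSnr mulnC modnMDl.
Qed.

Lemma count_value_uniq V a a' :
  count_value V a -> count_value V a' -> a = a' %[mod m.-1].
Proof.
move=> [L VL <-] [L' VL' <-].
wlog LL' : L L' VL VL' / L <= L'.
  by move=> wl; case: (leqP L L') => [|/ltnW] le; [apply: wl | apply/esym/wl].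
by rewrite -(subnKC LL') count_wordsD.
Qed.

Lemma count_value_exists V L : locally_constant V L -> exists a, count_value V a.
Proof. by move=> VL; exists (count_words V L), L. Qed.

Lemma count_words_sum (I : finType) (W : I -> (nat -> 'I_m) -> nat) V L :
  (forall s, V s = \sum_a W a s) ->
  count_words V L = \sum_a count_words (W a) L.
Proof.
elim: L V W => [|L IH] V W VE /=; first exact: VE.
rewrite exchange_big /=; apply: eq_bigr => c _.
exact: IH (fun s => VE (scat [:: c] s)).
Qed.

(** At a depth common to the finitely many summands the counts add up exactly. *)
Lemma count_value_sum (I : finType) (W : I -> (nat -> 'I_m) -> nat) V (f : I -> nat) :
  (forall s, V s = \sum_a W a s) -> (forall a, count_value (W a) (f a)) ->
  count_value V (\sum_a f a).
Proof.
move=> VE WP.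
have [L LP] : exists L : I -> nat, forall a, locally_constant (W a) (L a).
  apply: (fin_all_exists (P := fun a => locally_constant (W a))) => a.
  by have [L ? _] := WP a; exists L.
have WL a : locally_constant (W a) (\max_a L a).
  by apply: locally_constant_le (LP a); apply: leq_bigmax.
exists (\max_a L a).
  by move=> s s' e; rewrite !VE; apply: eq_bigr => a _; apply: WL.
rewrite (count_words_sum _ VE).
apply: (big_ind2 (fun a b => a = b %[mod m.-1])) => //.
  by move=> a b c d ab cd; rewrite -modnDm ab cd modnDm.
by move=> a _; apply: count_value_uniq (WP a); exists (\max_a L a).
Qed.

Definition cylinder w s : bool := mkseq s (size w) == w.

Lemma cylinderP w s : reflect (exists t, s = scat w t) (cylinder w s).
Proof.
apply: (iffP eqP) => [e|[t ->]]; last exact: mkseq_scat.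
by exists (sdrop (size w) s); rewrite -{1}e scat_mkseq.
Qed.

Lemma count_value_eqmod V a a' :
  a = a' %[mod m.-1] -> count_value V a -> count_value V a'.
Proof. by move=> aa' [L VL e]; exists L; rewrite // e. Qed.

Lemma count_cylinder w : count_value (fun s => cylinder w s) 1.
Proof.
exists (size w) => [s s' e|]; first by rewrite /cylinder e.
congr (_ %% _); elim: w => [|c w IH] //=.
rewrite (bigD1 c) //= big1 ?addn0 => [|c' cc'].
  rewrite -[RHS]IH; congr count_words; apply/funext => s.
  by rewrite /cylinder /= (mkseq_scatD [:: c]) /= eqseq_cons eqxx.
rewrite (_ : (fun s => _) = fun=> 0); first by elim: (size w) => //= L ->; rewrite big1.
apply/funext => s; rewrite /cylinder /= (mkseq_scatD [:: c']) /= eqseq_cons.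
by rewrite (negPf cc').
Qed.

End CylinderCounting.

(** Pointwise form of a disjoint union, as [count_value_sum] needs it. *)
Lemma indicator_sum (I : finType) (Q : pred I) (b : bool) :
  (forall a, Q a -> b) -> (b -> exists a, Q a) ->
  (forall a a', Q a -> Q a' -> a = a') -> b = (\sum_a Q a)%N :> nat.
Proof.
move=> Qb bQ Qu; case: b Qb bQ => [_ /(_ isT)[a Qa]|Qb _].
  rewrite (bigD1 a) //= Qa big1 // => a' a'a.
  by case Qa': (Q a') => //; rewrite (Qu _ _ Qa Qa') eqxx in a'a.
by rewrite big1 // => a _; case Qa: (Q a) => //; have := Qb a Qa.
Qed.

(** * Coordinate slices *)

Section Slices.
Variables (k : nat) (q : 'I_k -> nat).
Implicit Types (x y z : point q) (i : 'I_k).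

Definition upd x i (s : nat -> 'I_(q i)) : point q :=
  @dfwith _ (fun j => nat -> 'I_(q j)) x i s.

Definition msingle i (w : seq 'I_(q i)) : mword q :=
  @dfwith _ (fun j => seq 'I_(q j)) (@mnil _ q) i w.

Arguments upd : clear implicits.
Arguments msingle : clear implicits.

Definition on_slice i x y : Prop := forall j, j != i -> y j = x j.

Lemma upd_in x i s : upd x i s i = s.
Proof. exact: dfwith_in. Qed.

Lemma upd_out x i s j : j != i -> upd x i s j = x j.
Proof. by move=> ji; apply: dfwith_out; rewrite eq_sym. Qed.

Lemma msingle_in i w : msingle i w i = w.
Proof. exact: dfwith_in. Qed.

Lemma msingle_out i w j : j != i -> msingle i w j = [::].
Proof. by move=> ji; apply: dfwith_out; rewrite eq_sym. Qed.

Lemma on_slice_upd x i s : on_slice i x (upd x i s).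
Proof. by move=> j ji; apply: upd_out. Qed.

Lemma on_sliceE i x y : on_slice i x y -> y = upd x i (y i).
Proof.
move=> xy; apply: pointP => j; have [->|ji] := eqVneq j i.
  by rewrite upd_in.
by rewrite upd_out // xy.
Qed.

Lemma upd_id x i : upd x i (x i) = x.
Proof. by apply/esym/on_sliceE. Qed.

Lemma upd_inj x i s s' : upd x i s = upd x i s' -> s = s'.
Proof. by move=> e; rewrite -(upd_in x s) e upd_in. Qed.

Lemma mcat_single i w z : mcat (msingle i w) z = upd z i (scat w (z i)).
Proof.
apply: pointP => j; rewrite /mcat; have [->|ji] := eqVneq j i.
  by rewrite msingle_in upd_in.
by rewrite msingle_out // upd_out // scat_nil.
Qed.

Lemma mprefix_single i w x :
  mprefix (msingle i w) x = (mkseq (x i) (size w) == w).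
Proof.
apply/mprefixP/eqP => [/(_ i)|e j]; first by rewrite msingle_in.
have [->|ji] := eqVneq j i; first by rewrite msingle_in.
by rewrite msingle_out.
Qed.

Lemma mpre_upd N x i s : mkseq s N = mkseq (x i) N -> mpre N (upd x i s) = mpre N x.
Proof.
move=> e; apply: mwordP => j; rewrite /mpre; have [->|ji] := eqVneq j i.
  by rewrite upd_in.
by rewrite upd_out.
Qed.

Lemma mpre_upd2 N x i s s' :
  mkseq s N = mkseq s' N -> mpre N (upd x i s) = mpre N (upd x i s').
Proof.
move=> e; rewrite -(mpre_upd (i := i) (s := s) (x := upd x i s')) ?upd_in //.
congr mpre; apply: pointP => j; have [->|ji] := eqVneq j i.
  by rewrite !upd_in.
by rewrite !upd_out.
Qed.

End Slices.
Arguments upd {k q} x i s.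
Arguments msingle {k q} i w.

Section OtherLetter.
Variables (m : nat) (m_gt1 : (1 < m)%N).
Definition letter0 : 'I_m := Ordinal (ltnW m_gt1).
Definition letter1 : 'I_m := Ordinal m_gt1.
Definition other (c : 'I_m) := if c == letter0 then letter1 else letter0.

Lemma other_neq c : other c <> c.
Proof. by rewrite /other; case: eqP => [->|ne] e; [have := congr1 val e | case: ne]. Qed.

(** Witnesses that no infinite word is isolated. *)
Definition perturb N (s : nat -> 'I_m) : nat -> 'I_m :=
  scat (mkseq s N) (fun n => other (s (N + n)%N)).

Lemma mkseq_perturb N s : mkseq (perturb N s) N = mkseq s N.
Proof.
have e := size_mkseq s N.
by rewrite -{2}e /perturb mkseq_scat.
Qed.

Lemma perturb_neq N s : perturb N s <> s.
Proof.
move/(congr1 (fun f => f N)); rewrite /perturb /scat size_mkseq ltnn subnn addn0.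
exact: other_neq.
Qed.

End OtherLetter.

(** * Homeomorphisms that conjugate prefix replacements, and their action on slices *)

Definition uniformly_continuous k l (q : 'I_k -> nat) (r : 'I_l -> nat)
    (h : point r -> point q) :=
  forall M, exists N, forall y y', mpre N y = mpre N y' -> mpre M (h y) = mpre M (h y').

(* The conjugate [h^-1 o (u z |-> v z) o h] is a prefix replacement on cylinders
   whose depth [N] does not depend on the point. *)
Definition conjugates_replacements k l (q : 'I_k -> nat) (r : 'I_l -> nat)
    (h : point r -> point q) :=
  forall u v : mword q, exists N, forall y, mprefix u (h y) ->
    exists b : mword r, forall t, exists z,
      h (mcat (mpre N y) t) = mcat u z /\ h (mcat b t) = mcat v z.

(** The letters of [y] between depths [N0] and [N] can be appended to both the old and the new
    prefix. *)
Lemma conjugates_replacements_ge k l (q : 'I_k -> nat) (r : 'I_l -> nat)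
    (h : point r -> point q) : conjugates_replacements h ->
  forall u v : mword q, exists N0, forall N, (N0 <= N)%N -> forall y, mprefix u (h y) ->
    exists b : mword r, forall t, exists z,
      h (mcat (mpre N y) t) = mcat u z /\ h (mcat b t) = mcat v z.
Proof.
move=> hE u v; have [N0 NP] := hE u v; exists N0 => N N0N y uy.
have [b bP] := NP y uy.
exists (fun i => b i ++ mkseq (sdrop N0 (y i)) (N - N0)) => t.
have [z [z1 z2]] := bP (fun i => scat (mkseq (sdrop N0 (y i)) (N - N0)) (t i)).
exists z; split; [rewrite -z1|rewrite -z2]; congr h; apply: pointP => i.
  by rewrite /mcat /mpre -scat_cat -mkseqD subnKC.
by rewrite /mcat -scat_cat.
Qed.

Section SliceCorrespondence.
Variables (k l : nat) (q : 'I_k -> nat) (r : 'I_l -> nat).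
Variables (q_gt1 : forall i, (1 < q i)%N) (r_gt1 : forall j, (1 < r j)%N).
Variables (h : point q -> point r) (g : point r -> point q).
Hypotheses (hK : cancel h g) (gK : cancel g h).
Hypotheses (h_cont : uniformly_continuous h) (g_cont : uniformly_continuous g).
Hypotheses (h_conj : conjugates_replacements h) (g_conj : conjugates_replacements g).

Let x0 : point q := fun i _ => letter0 (q_gt1 i).
Let y0 := h x0.

Let scat_x0 i : scat [:: letter0 (q_gt1 i)] (x0 i) = x0 i.
Proof. by apply/funext => n; rewrite /scat /=; case: n. Qed.

(** The map prepending 0 in all coordinates but [i] fixes exactly the slice. Its conjugate is a
    prefix replacement near [y0], whose fixed points can be read off coordinate by coordinate. *)
Lemma slice_image i : exists N (J : pred 'I_l), forall y, mpre N y = mpre N y0 ->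
  (on_slice i x0 (g y) <-> forall j, ~~ J j -> y j = y0 j).
Proof.
pose v : mword q := fun i' => if i' == i then [::] else [:: letter0 (q_gt1 i')].
have [N NP] := g_conj (@mnil _ q) v.
have [|b bP] := NP y0; first by apply/mprefixP.
have vx0 : mcat v x0 = x0.
  by apply: pointP => i'; rewrite /mcat /v; case: eqP => _; rewrite ?scat_nil.
have nilE z : mcat (@mnil _ q) z = z by apply: pointP => i'; apply: scat_nil.
pose a := mpre N y0; pose tau := mdrop a y0.
have y0E : mcat a tau = y0 by apply: mcat_pre.
have by0 : mcat b tau = y0.
  have [z [zP1 zP2]] := bP tau.
  move: zP1; rewrite y0E nilE hK => zx0.
  by rewrite -[LHS]gK zP2 -zx0 vx0.
have abj j : scat (a j) (tau j) = scat (b j) (tau j).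
  by have := congr1 (fun f : point r => f j) (etrans y0E (esym by0)).
(* By [abj] both words are prefixes of [y0 j]. Equal lengths make them equal, so the coordinate is
   free; unequal lengths leave [tau j] as the only fixed tail. *)
exists N, (fun j => size (a j) == size (b j)) => y yN.
have yE : mcat a (mdrop a y) = y by rewrite /a -yN; apply: mcat_pre.
have [z [zP1 zP2]] := bP (mdrop a y).
have gyz : g y = z by rewrite -yE zP1 nilE.
have sliceE : on_slice i x0 (g y) <-> mcat b (mdrop a y) = y.
  have -> : (mcat b (mdrop a y) = y) <-> mcat v (g y) = g y.
    by rewrite gyz -zP2 -gyz; split=> [->|/(can_inj gK)].
  split=> [sl|e i' i'i].
    apply: pointP => i'; rewrite /mcat /v; case: eqP => [_|/eqP i'i].
      exact: scat_nil.
    by rewrite sl.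
  have := congr1 (fun f : point q => f i') e; rewrite /mcat /v (negPf i'i) => e'.
  by apply: scat_fix_uniq (esym e') (esym (scat_x0 i')).
rewrite sliceE; split=> [e j nJ|yJ].
  have ej := congr1 (fun f : point r => f j) (etrans yE (esym e)).
  have := scat_eq_uniq nJ ej (abj j); rewrite -{2}yE -y0E => /(congr1 (scat (a j))).
  exact.
apply: pointP => j; have ej := congr1 (fun f : point r => f j) yE.
rewrite -[RHS]ej /mcat; case: (boolP (size (a j) == size (b j))) => [/eqP sz|nJ].
  by have /(_ sz) -> := scat_injl _ (abj j).
by rewrite (_ : mdrop a y j = tau j) ?abj // /mdrop yJ.
Qed.

Lemma slice_image_single i : exists N j, forall y, mpre N y = mpre N y0 ->
  (on_slice i x0 (g y) <-> on_slice j y0 y).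
Proof.
have [N [J NJ]] := slice_image i.
(* If [J] were empty, [x0] would be isolated in its slice. *)
have [j Jj] : exists j, J j.
  apply: contrapT => nJ.
  have [M MP] := h_cont N.
  pose x := upd x0 i (perturb (q_gt1 i) M (x0 i)).
  have xM : mpre M x = mpre M x0 by apply/mpre_upd/mkseq_perturb.
  have /NJ[+ _] : mpre N (h x) = mpre N y0 by apply: MP.
  rewrite hK => /(_ (@on_slice_upd _ _ _ _ _)) xJ.
  have /(can_inj hK) xx0 : h x = h x0.
    by apply: pointP => j; apply: xJ; apply/negP => Jj; apply: nJ; exists j.
  apply: (@perturb_neq _ (q_gt1 i) M (x0 i)).
  by rewrite -(upd_in x0 (perturb _ _ _)) -/x xx0.
exists N, j => y yN; rewrite NJ //.
suff J1 j' : J j' -> j' = j.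
  split=> yJ j' => [j'j|nJ]; apply: yJ.
    by apply/negP => /J1/eqP; rewrite (negPf j'j).
  by apply/eqP => e; rewrite e Jj in nJ.
(* With two free coordinates, a replacement acting on coordinate [j] alone moves some points of the
   slice image near a fixed point and fixes others. On the single slice [i] its conjugate must do
   only one of these. *)
move=> Jj'; apply/eqP/negPn/negP => j'j.
have gS y' : mpre N y' = mpre N y0 -> (forall j, ~~ J j -> y' j = y0 j) ->
    on_slice i x0 (g y') by move=> y'N y'J; apply/NJ.
pose o := letter0 (r_gt1 j); pose w := mkseq (y0 j) N.
have oE : scat [:: o] (fun=> o) = fun=> o.
  by apply/funext => n; rewrite /scat /=; case: n.
pose y1 := upd y0 j (scat w (fun=> o)).
have y1N : mpre N y1 = mpre N y0.
  apply: mpre_upd; have {1}-> : N = size w by rewrite size_mkseq.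
  exact: mkseq_scat.
have y1J j0 : ~~ J j0 -> y1 j0 = y0 j0.
  by move=> nJ; apply: upd_out; apply: contraNneq nJ => ->.
(* Replacing [w] by [w o] in coordinate [j] fixes exactly the points whose [j]-th coordinate is [w]
   followed by [o] forever, as for [y1]. *)
pose u := msingle j w; pose v := msingle j (rcons w o).
have uvE z y' : y' j = y1 j -> mcat u z = y' -> mcat v z = y'.
  rewrite /u /v !mcat_single => y'j zy'.
  have := congr1 (fun f : point r => f j) zy'.
  rewrite /= upd_in y'j /y1 upd_in => /scat_injr zo.
  by rewrite -zy' zo scat_rcons oE.
have [N1 NP] := h_conj u v.
pose x1 := g y1; pose c := mpre N1 x1.
have x1S : on_slice i x0 x1 := gS _ y1N y1J.
have [b bP] : exists b, forall x, mpre N1 x = c -> exists z,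
    h x = mcat u z /\ h (mcat b (mdrop c x)) = mcat v z.
  have [|b bP] := NP x1.
    by rewrite gK mprefix_single /y1 upd_in mkseq_scat.
  exists b => x xc; have [z [z1 z2]] := bP (mdrop c x); exists z; split=> //.
  by rewrite -z1; congr h; rewrite -/c -xc mcat_pre.
have bx1 : mcat b (mdrop c x1) = x1.
  have [z [z1 z2]] := bP x1 erefl; apply: (can_inj hK).
  by rewrite z2 gK; rewrite gK in z1; apply: uvE (esym z1).
have [M MP] := g_cont N1; pose M2 := maxn M N.
have y2P j2 : J j2 -> let y2 := upd y1 j2 (perturb (r_gt1 j2) M2 (y1 j2)) in
    [/\ y2 <> y1, mpre N1 (g y2) = c & on_slice i x0 (g y2)].
  move=> Jj2 y2.
  have y2M : mpre M2 y2 = mpre M2 y1 by apply/mpre_upd/mkseq_perturb.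
  split.
  - move=> e; apply: (@perturb_neq _ (r_gt1 j2) M2 (y1 j2)).
    by rewrite -(upd_in y1 (perturb _ _ _)) -/y2 e.
  - by apply: MP; apply: mpre_le y2M; apply: leq_maxl.
  - apply: gS; first by rewrite -y1N; apply: mpre_le y2M; apply: leq_maxr.
    move=> j0 nJ; rewrite -y1J //; apply: upd_out.
    by apply: contraNneq nJ => ->.
(* Equal lengths: the conjugate is the identity on slice [i] near [x1]. Perturbing [y1] along [j]
   contradicts this. Otherwise [x1] is its only fixed point there, and perturbing [y1] along [j']
   gives another. *)
have [/eqP bi|bi] := boolP (size (b i) == N1).
  have /= := y2P j Jj; set y2 := upd _ _ _ => -[ne y2c y2S].
  have [z []] := bP (g y2) y2c.
  have -> : mcat b (mdrop c (g y2)) = g y2.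
    have gE : mcat c (mdrop c (g y2)) = g y2 by rewrite -y2c mcat_pre.
    rewrite -[RHS]gE; apply: pointP => i'.
    have x1E : mcat c (mdrop c x1) = x1 by apply: mcat_pre.
    have e' := congr1 (fun f : point q => f i') (etrans bx1 (esym x1E)).
    have [i'i|i'i] := eqVneq i' i.
      subst i'; rewrite /mcat; congr scat.
      by apply: scat_injl e'; rewrite bi size_mkseq.
    rewrite /mcat (_ : mdrop c (g y2) i' = mdrop c x1 i') //.
    by rewrite /mdrop (y2S _ i'i) (x1S _ i'i).
  rewrite gK => z1 z2; apply: ne.
  have := congr1 (fun f : point r => f j) (etrans (esym z1) z2).
  rewrite /u /v !mcat_single /= !upd_in scat_rcons => /scat_injr zj.
  have zo : z j = fun=> o by apply: scat_fix_uniq zj (esym oE).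
  apply: pointP => j0; have [->|j0j] := eqVneq j0 j.
    by rewrite z1 /u mcat_single upd_in zo /y1 upd_in.
  by rewrite /y2 upd_out.
have /= := y2P j' Jj'; set y2 := upd _ _ _ => -[ne y2c y2S].
have [z []] := bP (g y2) y2c; rewrite gK => z1 z2.
have y2j : y2 j = y1 j by apply: upd_out; rewrite eq_sym.
have bE : mcat b (mdrop c (g y2)) = g y2.
  apply: (can_inj hK); rewrite z2 gK; exact: uvE y2j (esym z1).
apply: ne; apply: (can_inj gK).
have gE : mcat c (mdrop c (g y2)) = g y2 by rewrite -y2c mcat_pre.
have x1E : mcat c (mdrop c x1) = x1 by apply: mcat_pre.
rewrite -/x1 (on_sliceE y2S) (on_sliceE x1S); congr upd.
rewrite -gE -x1E /mcat; congr scat.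
apply: (@scat_eq_uniq _ (b i) (c i)); first by rewrite size_mkseq.
  exact: (congr1 (fun f : point q => f i) (etrans bE (esym gE))).
exact: (congr1 (fun f : point q => f i) (etrans bx1 (esym x1E))).
Qed.

(** Cylinders of slice [i] near [x0] become clopen sets in slice [j], all of the same class [c0]
    modulo [(r j).-1]. Cutting one into [q i] pieces gives [q i * c0 = c0], and cutting a cylinder
    of slice [j] into such images shows that [c0] is invertible. *)
Lemma slice_divides i j N :
  (forall y, mpre N y = mpre N y0 -> (on_slice i x0 (g y) <-> on_slice j y0 y)) ->
  ((r j).-1 %| (q i).-1)%N.
Proof.
(* Slice points beginning with [M] zeros are mapped into the neighbourhood of [y0] where [sl]
   applies. *)
move=> sl; have [M MP] := h_cont N.
pose w0 := nseq M (letter0 (q_gt1 i)).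
pose a0 : nat -> 'I_(q i) := fun=> letter0 (q_gt1 i).
pose l0 := letter0 (r_gt1 j).
pose b0 : nat -> 'I_(r j) := fun=> letter0 (r_gt1 j).
have w0E : mkseq (x0 i) M = w0.
  apply: (@eq_from_nth _ (a0 0%N)); rewrite size_mkseq ?size_nseq // => n nM.
  by rewrite nth_mkseq // nth_nseq nM.
(* This describes, in coordinate [j], the image under [h] of the cylinder [w0 ++ w] of slice [i];
   [gup] and [hup] are the two directions. *)
pose P w s := mkseq s N = mkseq (y0 j) N /\
  mkseq (g (upd y0 j s) i) (size (w0 ++ w)) = w0 ++ w.
pose V w s : nat := `[< P w s >].
have gup w s : P w s -> exists t, g (upd y0 j s) = upd x0 i (scat (w0 ++ w) t).
  move=> [s1 s2]; have sN : mpre N (upd y0 j s) = mpre N y0 by apply: mpre_upd.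
  have /on_sliceE e := (sl _ sN).2 (@on_slice_upd _ _ _ _ _).
  exists (sdrop (size (w0 ++ w)) (g (upd y0 j s) i)).
  by rewrite -{1}s2 scat_mkseq.
have hup w t : exists2 s, h (upd x0 i (scat (w0 ++ w) t)) = upd y0 j s & P w s.
  set x := upd x0 i _.
  have xN : mpre N (h x) = mpre N y0.
    apply/MP/mpre_upd; rewrite scat_cat w0E.
    by have := mkseq_scat w0 (scat w t); rewrite size_nseq.
  have /on_sliceE hxE : on_slice j y0 (h x).
    by apply: (sl _ xN).1; rewrite hK; apply: on_slice_upd.
  exists (h x j) => //; split; first exact: (congr1 (fun f : mword r => f j) xN).
  by rewrite -hxE hK /x upd_in mkseq_scat.
have Vlc w : exists L, locally_constant (V w) L.
  have [L LP] := g_cont (size (w0 ++ w)); exists (maxn N L) => s s' e.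
  have eN := mkseq_le (leq_maxl N L) e; have eL := mkseq_le (leq_maxr N L) e.
  have := congr1 (fun f : mword q => f i) (LP _ _ (mpre_upd2 y0 eL)).
  by rewrite /mpre => gE; rewrite /V /P gE eN.
(* Replacing [w0 ++ w] by [w0 ++ w'] is conjugated to prefix replacements that send the cylinders
   making up [V w] to disjoint cylinders making up [V w'], so the two sets have equally many. *)
have Vmono w w' c : count_value l0 (V w) c -> count_value l0 (V w') c.
  have [N1 NP] := conjugates_replacements_ge g_conj
    (msingle i (w0 ++ w)) (msingle i (w0 ++ w')).
  have [L VL] := Vlc w; pose M1 := maxn (maxn N1 N) L.
  have M1N1 : (N1 <= M1)%N by rewrite /M1 -maxnA leq_maxl.
  have M1L : (L <= M1)%N by apply: leq_maxr.
  have M1P s s' : mkseq s M1 = mkseq s' M1 -> P w s -> P w s'.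
    by move=> e Ps; have := VL _ _ (mkseq_le M1L e);
      rewrite /V (asboolT Ps); case: asboolP.
  have betaP s : P w s -> exists beta, forall t, P w' (scat beta t) /\
      exists z, g (upd y0 j (scat (mkseq s M1) t)) = upd x0 i (scat (w0 ++ w) z) /\
                g (upd y0 j (scat beta t)) = upd x0 i (scat (w0 ++ w') z).
    move=> Ps; have [|b bP] := NP M1 M1N1 (upd y0 j s).
      by rewrite mprefix_single Ps.2.
    exists (b j) => t.
    (* Outside [j] the tail is that of [y0], so that the source point lies on the slice through
       [y0]. The target point does too, because [g] sends it to slice [i]. *)
    have [z [z1 z2]] := bP (upd (mdrop (mpre M1 y0) y0) j t).
    set s' := scat (mkseq s M1) t.
    have aE : mcat (mpre M1 (upd y0 j s)) (upd (mdrop (mpre M1 y0) y0) j t) =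
        upd y0 j s'.
      apply: pointP => j'; rewrite /mcat /mpre; have [->|j'j] := eqVneq j' j.
        by rewrite !upd_in.
      by rewrite !upd_out // /mdrop size_mkseq scat_mkseq.
    have Ps' : P w s'.
      by apply: M1P Ps; rewrite mkseq_scat_size ?size_mkseq.
    have [t' t'E] := gup _ _ Ps'.
    rewrite aE t'E mcat_single in z1.
    have zi : z i = t'.
      have := congr1 (fun f : point q => f i) z1; rewrite /= !upd_in.
      by move/scat_injr.
    have vE : mcat (msingle i (w0 ++ w')) z = upd x0 i (scat (w0 ++ w') t').
      rewrite mcat_single zi; apply: pointP => i'; have [->|i'i] := eqVneq i' i.
        by rewrite !upd_in.
      have := congr1 (fun f : point q => f i') z1.
      by rewrite /= !upd_out.
    have [s'' s''E Ps''] := hup w' t'.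
    rewrite vE in z2; have bE := congr1 h z2; rewrite gK s''E in bE.
    have bj : scat (b j) t = s''.
      by have := congr1 (fun f : point r => f j) bE; rewrite /mcat !upd_in.
    rewrite bj; split=> //; exists t'; split; first exact: t'E.
    by rewrite -s''E hK.
  pose I : finType := {alpha : M1.-tuple 'I_(r j) | `[< P w (scat alpha b0) >]}.
  have IP (alpha : I) : P w (scat (val alpha) b0) by have /asboolP := valP alpha.
  have mkI (alpha : I) s : mkseq (scat (val alpha) s) M1 = val alpha.
    by rewrite mkseq_scat_size ?size_tuple.
  have [beta betaE] := choice (fun alpha : I => betaP _ (IP alpha)).
  have VI : count_value l0 (V w) #|I|.
    have <- : (\sum_(alpha : I) 1 = #|I|)%N by rewrite sum1_card.
    apply: (@count_value_sum _ l0 I (fun alpha s => cylinder (val alpha) s) _ (fun=> 1%N)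
      _ (fun alpha => count_cylinder l0 (val alpha))).
    move=> s; apply: indicator_sum.
    - move=> alpha /cylinderP[t ->]; apply/asboolP; apply: M1P (IP alpha).
      by rewrite !mkI.
    - move=> /asboolP Ps; have sz : size (mkseq s M1) == M1 by rewrite size_mkseq.
      have Pa : P w (scat (Tuple sz) b0).
        by apply: M1P Ps; rewrite mkseq_scat_size ?size_mkseq.
      exists (exist _ (Tuple sz) (asboolT Pa)); apply/cylinderP.
      by exists (sdrop M1 s); rewrite /= scat_mkseq.
    - move=> alpha alpha' /cylinderP[t ->] /cylinderP[t' e].
      by apply/val_inj/val_inj; rewrite /= -(mkI alpha t) e mkI.
  move=> Vc; apply: count_value_eqmod (count_value_uniq VI Vc) _.
  have <- : (\sum_(alpha : I) 1 = #|I|)%N by rewrite sum1_card.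
  apply: (@count_value_sum _ l0 I (fun alpha s => cylinder (beta alpha) s) _ (fun=> 1%N)
      _ (fun alpha => count_cylinder l0 (beta alpha))).
  move=> s; apply: indicator_sum.
  - move=> alpha /cylinderP[t ->]; apply/asboolP.
    by have [] := betaE alpha t.
  - move=> /asboolP Ps; have [t tE] := gup _ _ Ps.
    have [s' s'E Ps'] := hup w t.
    have sz : size (mkseq s' M1) == M1 by rewrite size_mkseq.
    have Pa : P w (scat (Tuple sz) b0).
      by apply: M1P Ps'; rewrite mkseq_scat_size ?size_mkseq.
    pose alpha : I := exist _ (Tuple sz) (asboolT Pa).
    exists alpha; apply/cylinderP; exists (sdrop M1 s').
    have [_ [z]] := betaE alpha (sdrop M1 s'); rewrite mkI /= scat_mkseq => -[].
    rewrite -s'E hK => /upd_inj/scat_injr <-; rewrite -tE => /(can_inj gK)/upd_inj.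
    by move->.
  - move=> alpha alpha' /cylinderP[t tE] /cylinderP[t' t'E].
    have [_ [z []]] := betaE alpha t; have [_ [z' []]] := betaE alpha' t'.
    rewrite -tE -t'E !mkI => e1' -> e1 /upd_inj/scat_injr zz'.
    rewrite zz' -e1 in e1'; have /upd_inj e := can_inj gK e1'.
    by apply/val_inj/val_inj; rewrite /= -(mkI alpha t) -e mkI.
have [c0 Vc0] : exists c, count_value l0 (V [::]) c.
  by have [L VL] := Vlc [::]; apply: count_value_exists VL.
have VC w : count_value l0 (V w) c0 by apply: Vmono Vc0.
(* The cylinder [w0] is the disjoint union of the cylinders [w0 c] over the letters [c]. *)
have c0E : (q i * c0 = c0 %[mod (r j).-1])%N.
  apply: (@count_value_uniq _ l0 (V [::])); last exact: Vc0.
  have <- : (\sum_(c < q i) c0 = q i * c0)%N by rewrite sum_nat_const card_ord.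
  apply: (@count_value_sum _ l0 _ (fun c : 'I_(q i) => V [:: c]) _ (fun=> c0) _
    (fun c => VC [:: c])) => s.
  apply: indicator_sum.
  - move=> c /asboolP Pc; apply/asboolP; split; first exact: Pc.1.
    have [t ->] := gup _ _ Pc.
    by rewrite upd_in cats0 scat_cat mkseq_scat.
  - move=> /asboolP Ps; have [t tE] := gup _ _ Ps.
    exists (t 0%N); apply/asboolP; split; first exact: Ps.1.
    rewrite tE upd_in cats0 size_cat mkseq_scatD; congr (_ ++ _).
  - move=> c c' /asboolP[_ Pc] /asboolP[_ Pc'].
    have : w0 ++ [:: c] = w0 ++ [:: c'] by rewrite -Pc -Pc' !size_cat.
    by move/eqP; rewrite eqseq_cat // eqxx => /eqP[].
have [L VL] := Vlc [::].
(* A cylinder around [y0 j] contained in [V [::]]. The depth [M2] is large enough for each image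
   [V w] with [w] of length [M2] to lie inside [rho] or miss it. *)
pose rho := mkseq (y0 j) L.
have [M2 M2P] := h_cont L.
pose hh (w : seq 'I_(q i)) := h (upd x0 i (scat (w0 ++ w) a0)) j.
pose I2 : finType := {w : M2.-tuple 'I_(q i) | cylinder rho (hh w)}.
have hhE s (w : M2.-tuple 'I_(q i)) : P w s -> cylinder rho s = cylinder rho (hh w).
  move=> Ps; have [t tE] := gup _ _ Ps.
  rewrite /cylinder /rho size_mkseq; congr (_ == _).
  have : mpre L (upd y0 j s) = mpre L (h (upd x0 i (scat (w0 ++ w) a0))).
    rewrite -[upd y0 j s]gK tE; apply/M2P/mpre_upd2/mkseq_scat_le.
    by rewrite size_cat size_tuple leq_addl.
  by move/(congr1 (fun f : mword r => f j)); rewrite /mpre upd_in.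
have n2E : (#|I2| * c0 = 1 %[mod (r j).-1])%N.
  apply: (@count_value_uniq _ l0 (fun s => cylinder rho s)); last exact: count_cylinder.
  have <- : (\sum_(w : I2) c0 = #|I2| * c0)%N by rewrite sum_nat_const.
  apply: (@count_value_sum _ l0 _ (fun w : I2 => V (val w)) _ (fun=> c0) _
    (fun w => VC (val w))) => s.
  apply: indicator_sum.
  - by move=> w /asboolP /hhE ->; exact: (valP w).
  - move=> rs.
    have Ps : P [::] s.
      have /eqP := rs; rewrite size_mkseq => /VL; rewrite /V.
      have y0P : P [::] (y0 j).
        split=> //; rewrite upd_id hK cats0 -w0E /x0 size_mkseq //.
      by rewrite (asboolT y0P); case: asboolP.
    have [t tE] := gup _ _ Ps.
    have sz : size (mkseq t M2) == M2 by rewrite size_mkseq.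
    have Pw : P (Tuple sz) s.
      split; first exact: Ps.1.
      by rewrite tE upd_in cats0 /= size_cat size_mkseq mkseq_scatD.
    have rw : cylinder rho (hh (Tuple sz)) by rewrite -(hhE s (Tuple sz)).
    by exists (exist _ (Tuple sz) rw); apply/asboolP.
  - move=> w w' /asboolP[_ Pw] /asboolP[_ Pw'].
    have : w0 ++ val w = w0 ++ val w'.
      by rewrite -Pw -Pw' !size_cat !size_tuple.
    by move/eqP; rewrite eqseq_cat // eqxx => /eqP/val_inj/val_inj.
have : (q i = 1 %[mod (r j).-1])%N.
  rewrite -[q i]muln1 -modnMmr -n2E modnMmr mulnCA -modnMmr c0E modnMmr.
  by rewrite n2E.
by move/eqP; rewrite eqn_mod_dvd ?subn1 // ltnW.
Qed.
Theorem slice_injection : exists2 sigma : 'I_k -> 'I_l, injective sigma &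
  forall i, ((r (sigma i)).-1 %| (q i).-1)%N.
Proof.
have [N NP] := choice (fun i => slice_image_single i).
have [sigma sP] := choice NP.
exists sigma => [i i' ss|i]; last exact: slice_divides (sP i).
apply: contrapT => /eqP ii'.
pose M := maxn (N i) (N i').
(* A point near [y0], distinct from it, on the common image slice: [g y] would lie on the slices of
   both [i] and [i'], which meet only in [x0]. *)
pose y := upd y0 (sigma i) (perturb (r_gt1 (sigma i)) M (y0 (sigma i))).
have yM : mpre M y = mpre M y0 by apply/mpre_upd/mkseq_perturb.
have yi : on_slice i x0 (g y).
  apply/(sP i); last exact: on_slice_upd.
  by apply: mpre_le yM; apply: leq_maxl.
have yi' : on_slice i' x0 (g y).
  apply/(sP i'); last by rewrite -ss; apply: on_slice_upd.
  by apply: mpre_le yM; apply: leq_maxr.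
apply: (@perturb_neq _ (r_gt1 (sigma i)) M (y0 (sigma i))).
rewrite -(upd_in y0 (perturb _ _ _)) -/y; suff -> : y = y0 by [].
apply: (can_inj gK); rewrite hK; apply: pointP => j.
by have [->|ji] := eqVneq j i; [apply: yi' | apply: yi].
Qed.

End SliceCorrespondence.

(** Cardinalities give [k = l], so both injections are permutations. The sums of the entries then
    agree, which turns every inequality along [sigma] into an equality. *)
Lemma tuple_eq_from_injections (k l : nat) (n : k.-tuple nat) (m : l.-tuple nat)
    (sigma : 'I_k -> 'I_l) (tau : 'I_l -> 'I_k) :
  sorted leq n -> sorted leq m -> injective sigma -> injective tau ->
  (forall i, tnth m (sigma i) <= tnth n i)%N ->
  (forall j, tnth n (tau j) <= tnth m j)%N ->
  k = l /\ n = m :> seq nat.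
Proof.
move=> n_sorted m_sorted sI tI sle tle.
have kl : k = l.
  apply/eqP; rewrite eqn_leq.
  have := leq_card sigma sI; have := leq_card tau tI.
  by rewrite !card_ord => -> ->.
split=> //; subst l; apply: (sorted_eq leq_trans anti_leq) => //.
have sumE (t : k.-tuple nat) (f : 'I_k -> 'I_k) : injective f ->
    (\sum_i tnth t (f i) = \sum_i tnth t i)%N.
  by move=> fI; rewrite [RHS](reindex_inj fI).
apply/tuple_permP; exists (perm sI); congr (tval _).
apply: eq_from_tnth => i; rewrite tnth_mktuple permE.
apply/eqP; rewrite eqn_leq sle andbT leqNgt; apply/negP => lt_i.
have : (\sum_i tnth m (sigma i) < \sum_i tnth n i)%N.
  rewrite (bigD1 i) //= [X in (_ < X)%N](bigD1 i) //= -addSn.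
  by apply: leq_add => //; apply: leq_sum.
rewrite sumE // -(sumE n tau) //; apply/negP; rewrite -leqNgt.
exact: leq_sum.
Qed.

(** * Linear endomorphisms and words in the Leavitt algebra *)

Section LinearEndomorphisms.
Variables (R : comNzRingType) (V : lmodType R).

(** Bundled so as to carry a [ualgType] structure, the target required by [leavitt_universal]. *)
Record lin_end := LinEnd { lin_fun :> V -> V; lin_funP : linear lin_fun }.

Lemma lin_fun0 (f : lin_end) : f 0 = 0.
Proof. by have := lin_funP f (- 1) 0 0; rewrite scaler0 addr0 scaleN1r addNr. Qed.

Lemma lin_end_eq (f g : lin_end) : (forall x, f x = g x) -> f = g.
Proof.
case: f => f fP; case: g => g gP /= /funext fg; move: fP; rewrite fg => fP.
by rewrite (Prop_irrelevance fP gP).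
Qed.

HB.instance Definition _ := gen_eqMixin lin_end.
HB.instance Definition _ := gen_choiceMixin lin_end.

Fact lin_add_subproof (f g : lin_end) : linear (fun x => f x + g x).
Proof.
move=> a x y; rewrite !(lin_funP f, lin_funP g) scalerDr !addrA.
by congr (_ + _); rewrite addrAC.
Qed.
Fact lin_scale_subproof r (f : lin_end) : linear (fun x => r *: f x).
Proof. by move=> a x y; rewrite (lin_funP f) scalerDr !scalerA mulrC. Qed.
Fact lin_zero_subproof : linear (fun _ : V => 0 : V).
Proof. by move=> a x y; rewrite scaler0 addr0. Qed.
Fact lin_one_subproof : linear (fun x : V => x).
Proof. by []. Qed.
Fact lin_comp_subproof (f g : lin_end) : linear (fun x => f (g x)).
Proof. by move=> a x y; rewrite (lin_funP g) (lin_funP f). Qed.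

Definition lin_add f g := LinEnd (lin_add_subproof f g).
Definition lin_scale r f := LinEnd (lin_scale_subproof r f).
Definition lin_zero := LinEnd lin_zero_subproof.
Definition lin_one := LinEnd lin_one_subproof.
Definition lin_comp f g := LinEnd (lin_comp_subproof f g).

Fact lin_addA : associative lin_add.
Proof. by move=> f g h; apply: lin_end_eq => x /=; rewrite addrA. Qed.
Fact lin_addC : commutative lin_add.
Proof. by move=> f g; apply: lin_end_eq => x /=; rewrite addrC. Qed.
Fact lin_add0 : left_id lin_zero lin_add.
Proof. by move=> f; apply: lin_end_eq => x /=; rewrite add0r. Qed.
Fact lin_addN : left_inverse lin_zero (lin_scale (- 1)) lin_add.
Proof. by move=> f; apply: lin_end_eq => x /=; rewrite scaleN1r addNr. Qed.

HB.instance Definition _ :=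
  GRing.isZmodule.Build lin_end lin_addA lin_addC lin_add0 lin_addN.

Fact lin_compA : associative lin_comp.
Proof. by move=> f g h; apply: lin_end_eq. Qed.
Fact lin_comp1 : left_id lin_one lin_comp.
Proof. by move=> f; apply: lin_end_eq. Qed.
Fact lin_compr1 : right_id lin_one lin_comp.
Proof. by move=> f; apply: lin_end_eq. Qed.
Fact lin_compDl : left_distributive lin_comp lin_add.
Proof. by move=> f g h; apply: lin_end_eq. Qed.
Fact lin_compDr : right_distributive lin_comp lin_add.
Proof.
move=> f g h; apply: lin_end_eq => x /=.
by have := lin_funP f 1 (g x) (h x); rewrite !scale1r.
Qed.

HB.instance Definition _ :=
  GRing.Zmodule_isPzRing.Build lin_end lin_compA lin_comp1 lin_compr1
    lin_compDl lin_compDr.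

Fact lin_scaleA r s f : lin_scale r (lin_scale s f) = lin_scale (r * s) f.
Proof. by apply: lin_end_eq => x /=; rewrite scalerA. Qed.
Fact lin_scale1 : left_id 1 lin_scale.
Proof. by move=> f; apply: lin_end_eq => x /=; rewrite scale1r. Qed.
Fact lin_scaleDr : right_distributive lin_scale +%R.
Proof. by move=> r f g; apply: lin_end_eq => x /=; rewrite scalerDr. Qed.
Fact lin_scaleDl f : {morph lin_scale^~ f : r s / r + s}.
Proof. by move=> r s; apply: lin_end_eq => x /=; rewrite scalerDl. Qed.
Fact lin_scaleAl r (f g : lin_end) : lin_scale r (f * g) = lin_scale r f * g.
Proof. exact: lin_end_eq. Qed.
Fact lin_scaleAr r (f g : lin_end) : lin_scale r (f * g) = f * lin_scale r g.
Proof.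
apply: lin_end_eq => x /=; have := lin_funP f r (g x) 0.
by rewrite lin_fun0 !addr0.
Qed.

HB.instance Definition _ := GRing.Zmodule_isLmodule.Build R lin_end
  lin_scaleA lin_scale1 lin_scaleDr lin_scaleDl.
HB.instance Definition _ := PzRing_isUAlgebra.Build R lin_end
  lin_scaleA lin_scale1 lin_scaleDr lin_scaleDl lin_scaleAl lin_scaleAr.

Lemma lin_mulE (f g : lin_end) x : (f * g) x = f (g x).
Proof. by []. Qed.
End LinearEndomorphisms.

Section Words.
Variables (R : comNzRingType) (n : nat).
Local Notation L := (leavitt R n).
Implicit Types w : seq 'I_n.

Definition word_e w : L := \prod_(c <- w) leavitt_e R c.
Definition word_es w : L := \prod_(c <- rev w) leavitt_es R c.

Lemma word_e_nil : word_e [::] = 1.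
Proof. exact: big_nil. Qed.
Lemma word_es_nil : word_es [::] = 1.
Proof. exact: big_nil. Qed.
Lemma word_e_cons c w : word_e (c :: w) = leavitt_e R c * word_e w.
Proof. exact: big_cons. Qed.
Lemma word_es_cons c w : word_es (c :: w) = word_es w * leavitt_es R c.
Proof. by rewrite /word_es rev_cons big_rcons. Qed.
Lemma word_e_rcons w c : word_e (rcons w c) = word_e w * leavitt_e R c.
Proof. exact: big_rcons. Qed.
Lemma word_es_rcons w c : word_es (rcons w c) = leavitt_es R c * word_es w.
Proof. by rewrite /word_es rev_rcons big_cons. Qed.

Lemma leavitt_ind (P : L -> Prop) :
  (forall c, P (leavitt_e R c)) -> (forall c, P (leavitt_es R c)) ->
  (forall r, P (r *: (1 : L))) -> (forall x y, P x -> P y -> P (x + y)) ->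
  (forall x y, P x -> P y -> P (x * y)) -> forall x, P x.
Proof.
move=> Pe Pes Pc PD PM x; have [a ->] := pclass_surj x.
elim: a => [[c|c]|r|a IHa b IHb|a IHa b IHb].
- exact: Pe.
- exact: Pes.
- have -> : pclass (leavitt_rel (n := n)) (Const r) = r *: (1 : L).
    exact/esym/(pmulr1 (pclass _ (Const r))).
  exact: Pc.
- by rewrite -paddE; apply: PD.
- by rewrite -pmulE; apply: PM.
Qed.

(** Inserting the sum of all [e_c e_c^*] in the middle lengthens both words by one letter. *)
Lemma word_split w w' :
  word_e w * word_es w' = \sum_(c < n) word_e (rcons w c) * word_es (rcons w' c).
Proof.
rewrite -[word_e w]mulr1 -(leavitt_sum_e_es R n) big_distrr /= big_distrl /=.
by apply: eq_bigr => c _; rewrite word_e_rcons word_es_rcons !mulrA.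
Qed.

End Words.

(** * The representation on functions of infinite words *)

Section Representation.
Variables (R : comNzRingType) (k : nat) (q : 'I_k -> nat).
Local Notation X := (point q).
Local Notation E := (lin_end (X -> R^o)).
Local Notation L i := (leavitt R (q i)).
Local Notation A := (tensor (fun i => L i)).
Implicit Types (sigma : X -> X).

Fact wsub_subproof (c : X -> R) sigma : 
  linear (fun (f : X -> R^o) x => c x * f (sigma x) : R^o).
Proof.
move=> a f g; apply/funext => x; rewrite /GRing.scale /= [LHS]mulrDr.
by rewrite mulrCA.
Qed.

(** Weighted composition operators are closed under products; the generators, the matrix units and
    the diagonal all act through them. *)
Definition wsub (c : X -> R) sigma : E := LinEnd (wsub_subproof c sigma).

Lemma wsubE c sigma f x : wsub c sigma f x = c x * f (sigma x).
Proof. by []. Qed.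

Lemma wsub_eq c c' sigma sigma' : (forall x, c x = c' x) ->
  (forall x, c x != 0 -> sigma x = sigma' x) -> wsub c sigma = wsub c' sigma'.
Proof.
move=> cc' ss'; apply: lin_end_eq => f; apply/funext => x.
rewrite !wsubE -cc'; have [->|c0] := eqVneq (c x) 0; first by rewrite !mul0r.
by rewrite ss'.
Qed.

Lemma wsub_mul c c' sigma sigma' :
  wsub c sigma * wsub c' sigma' =
  wsub (fun x => c x * c' (sigma x)) (sigma' \o sigma).
Proof.
by apply: lin_end_eq => f; apply/funext => x; rewrite lin_mulE !wsubE mulrA.
Qed.

Lemma wsub_one : wsub (fun=> 1) id = 1.
Proof. by apply: lin_end_eq => f; apply/funext => x; rewrite wsubE mul1r. Qed.

(** [gen_op c] transports a function to the cylinder of [c] and extends it by zero; [gens_op c]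
    reads it on that cylinder. *)
Definition gen_op i (c : 'I_(q i)) : E :=
  wsub (fun x => (x i 0%N == c)%:R) (fun x => upd x i (sdrop 1 (x i))).
Definition gens_op i (c : 'I_(q i)) : E :=
  wsub (fun=> 1) (fun x => upd x i (scat [:: c] (x i))).

Lemma upd_upd (x : X) i s s' : upd (upd x i s) i s' = upd x i s'.
Proof.
apply: pointP => j; have [->|ji] := eqVneq j i; first by rewrite !upd_in.
by rewrite !upd_out.
Qed.

Lemma updC (x : X) i j s s' : i != j ->
  upd (upd x i s) j s' = upd (upd x j s') i s.
Proof.
move=> ij; apply: pointP => i'; have [->|i'i] := eqVneq i' i.
  by rewrite upd_in upd_out // upd_in.
rewrite [RHS]upd_out //; have [->|i'j] := eqVneq i' j; first by rewrite !upd_in.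
by rewrite !upd_out.
Qed.

Lemma gens_gen i (c c' : 'I_(q i)) : gens_op c * gen_op c' = (c == c')%:R.
Proof.
rewrite /gens_op /gen_op wsub_mul; have [<-|cc'] := eqVneq c c'.
  rewrite -wsub_one; apply: wsub_eq => x.
    by rewrite mul1r upd_in /scat /= eqxx.
  by rewrite /= upd_upd upd_in (sdrop_scat [:: c]) upd_id.
apply: lin_end_eq => f; apply/funext => x; rewrite wsubE upd_in /scat /=.
by rewrite (negPf cc') mulr0 mul0r.
Qed.

Lemma sum_gen_gens i : \sum_(c < q i) gen_op c * gens_op c = 1.
Proof.
have sumE (F : 'I_(q i) -> E) f x : (\sum_c F c) f x = \sum_c F c f x.
  by elim/big_ind2: _ => // e y e' y' <- <-.
apply: lin_end_eq => f; apply/funext => x; rewrite sumE /gens_op /gen_op.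
rewrite (bigD1 (x i 0%N)) //= big1 => [|c cx]; last first.
  by rewrite eq_sym (negPf cx) !mul0r.
rewrite addr0 eqxx !mul1r upd_in upd_upd.
have -> : scat [:: x i 0%N] (sdrop 1 (x i)) = x i by exact: (scat_mkseq 1 (x i)).
by rewrite upd_id.
Qed.

Lemma rho_exists i : exists phi : L i -> E,
    [/\ scalable phi, {morph phi : x y / x + y}, phi 1 = 1,
        {morph phi : x y / x * y} &
        forall c : 'I_(q i), phi (leavitt_e R c) = gen_op c /\
          phi (leavitt_es R c) = gens_op c].
Proof.
have [phi [phiP _]] := leavitt_universal (@gens_gen i) (sum_gen_gens i).
by exists phi.
Qed.

Definition rho i : L i -> E := sval (cid (rho_exists i)).
Arguments rho : clear implicits.

Lemma rhoP i : [/\ scalable (rho i), {morph rho i : x y / x + y}, rho i 1 = 1,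
        {morph rho i : x y / x * y} &
        forall c : 'I_(q i), rho i (leavitt_e R c) = gen_op c /\
          rho i (leavitt_es R c) = gens_op c].
Proof. exact: svalP (cid (rho_exists i)). Qed.

Lemma rhoZ i r (x : L i) : rho i (r *: x) = r *: rho i x.
Proof. by case: (rhoP i) => sc _ _ _ _; apply: sc. Qed.
Lemma rhoD i : {morph rho i : x y / x + y}.
Proof. by case: (rhoP i). Qed.
Lemma rho1 i : rho i 1 = 1.
Proof. by case: (rhoP i). Qed.
Lemma rhoM i : {morph rho i : x y / x * y}.
Proof. by case: (rhoP i). Qed.
Lemma rho_e i (c : 'I_(q i)) : rho i (leavitt_e R c) = gen_op c.
Proof. by case: (rhoP i) => _ _ _ _ /(_ c)[]. Qed.
Lemma rho_es i (c : 'I_(q i)) : rho i (leavitt_es R c) = gens_op c.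
Proof. by case: (rhoP i) => _ _ _ _ /(_ c)[]. Qed.

Lemma rho_commute i j (a : L i) (b : L j) : i != j ->
  rho i a * rho j b = rho j b * rho i a.
Proof.
move=> ij; have ji : j != i by rewrite eq_sym.
(* Commutation need only be checked on generators; this is used for [b] first, and the induction on
   [a] follows. *)
have base (e : E) : (forall c, gen_op (c : 'I_(q j)) * e = e * gen_op c) ->
    (forall c, gens_op (c : 'I_(q j)) * e = e * gens_op c) ->
    forall b, rho j b * e = e * rho j b.
  move=> eg egs; elim/leavitt_ind => [c'|c'|r|x y IHx IHy|x y IHx IHy].
  - by rewrite rho_e.
  - by rewrite rho_es.
  - by rewrite rhoZ rho1 -ualg_scalerAl -ualg_scalerAr mul1r mulr1.
  - by rewrite rhoD mulrDl mulrDr IHx IHy.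
  - by rewrite rhoM -mulrA IHy !mulrA IHx.
move: a; elim/leavitt_ind => [c|c|r|x y IHx IHy|x y IHx IHy].
- rewrite rho_e; apply/esym/base => d; rewrite /gen_op /gens_op !wsub_mul.
    by apply: wsub_eq => x /=; [rewrite ?upd_out // mulrC|rewrite !upd_out // updC].
  by apply: wsub_eq => x /=; [rewrite ?upd_out // mulrC|rewrite !upd_out // updC].
- rewrite rho_es; apply/esym/base => d; rewrite /gen_op /gens_op !wsub_mul.
    by apply: wsub_eq => x /=; [rewrite ?upd_out // mulrC|rewrite !upd_out // updC].
  by apply: wsub_eq => x /=; [rewrite ?upd_out // mulrC|rewrite !upd_out // updC].
- by rewrite rhoZ rho1 -ualg_scalerAl -ualg_scalerAr mul1r mulr1.
- by rewrite rhoD mulrDl mulrDr IHx IHy.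
- by rewrite rhoM -mulrA IHy !mulrA IHx.
Qed.


Lemma rho_word i (w w' : seq 'I_(q i)) :
  rho i (word_e R w * word_es R w') =
  wsub (fun x => (mkseq (x i) (size w) == w)%:R)
       (fun x => upd x i (scat w' (sdrop (size w) (x i)))).
Proof.
have rw : rho i (word_e R w) = wsub (fun x => (mkseq (x i) (size w) == w)%:R)
       (fun x => upd x i (sdrop (size w) (x i))).
  elim: w => [|c w IH].
    rewrite word_e_nil rho1 -wsub_one; apply: wsub_eq => x //= _.
    by rewrite sdrop0 upd_id.
  rewrite word_e_cons rhoM rho_e IH /gen_op wsub_mul; apply: wsub_eq => x.
    rewrite upd_in -natrM mulnb; congr (_%:R).
    by rewrite -[size (c :: w)]/(1 + size w)%N mkseqD /= eqseq_cons /mkseq /=.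
  by move=> _ /=; rewrite upd_upd upd_in sdropD.
have rw' : rho i (word_es R w') =
    wsub (fun=> 1) (fun x => upd x i (scat w' (x i))).
  elim: w' => [|c w' IH].
    rewrite word_es_nil rho1 -wsub_one; apply: wsub_eq => x //= _.
    by rewrite scat_nil upd_id.
  rewrite word_es_cons rhoM rho_es IH /gens_op wsub_mul; apply: wsub_eq => x.
    by rewrite mul1r.
  by move=> _ /=; rewrite upd_upd upd_in [in RHS]scat_cons.
rewrite rhoM rw rw' wsub_mul; apply: wsub_eq => x; first by rewrite mulr1.
by move=> _ /=; rewrite upd_upd upd_in.
Qed.

Local Notation entry := (entries (fun i => L i)).

Definition rep_pure (a : entry) : E := \prod_(i < k) rho i (a i).

(** The outer factors do not depend on [y], so linearity in the [i]-th entry reduces to that of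
    [rho i]. *)
Lemma rep_prod_dfwith s (a : entry) i (x : L i) : uniq s -> i \in s ->
  exists e e' : E, forall y : L i,
    \prod_(j <- s) rho j (dfwith a y j) = e * rho i y * e'.
Proof.
elim: s => //= j s IH /andP[js us]; rewrite inE; have [eij _|ij /= si] := eqVneq i j.
  subst j; exists 1, (\prod_(j <- s) rho j (a j)) => y.
  rewrite big_cons dfwith_in mul1r; congr (_ * _); apply: eq_big_seq => j' j's.
  by rewrite dfwith_out //; apply: contraNneq js => ->.
have [e [e' ee']] := IH us si; exists (rho j (a j) * e), e' => y.
by rewrite big_cons ee' dfwith_out // !mulrA.
Qed.

Lemma rep_pure_multilinear : multilinear rep_pure.
Proof.
split=> a i.
  move=> x y; have [e [e' ee']] :=
    rep_prod_dfwith a x (index_enum_uniq 'I_k) (mem_index_enum i).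
  by rewrite /rep_pure !ee' rhoD mulrDr mulrDl.
move=> r x; have [e [e' ee']] :=
  rep_prod_dfwith a x (index_enum_uniq 'I_k) (mem_index_enum i).
by rewrite /rep_pure !ee' rhoZ -ualg_scalerAr -ualg_scalerAl.
Qed.

Lemma rho_commute_prod s (a : entry) i (x : L i) : i \notin s ->
  rho i x * \prod_(j <- s) rho j (a j) = \prod_(j <- s) rho j (a j) * rho i x.
Proof.
elim: s => [_|j s IH]; first by rewrite big_nil mul1r mulr1.
rewrite inE negb_or => /andP[ij si]; rewrite big_cons mulrA rho_commute //.
by rewrite -mulrA IH // mulrA.
Qed.

Lemma rep_pure_mul (a b : entry) : rep_pure (Defs.mulf a b) = rep_pure a * rep_pure b.
Proof.
rewrite /rep_pure.
elim: (index_enum 'I_k) (index_enum_uniq 'I_k) => [_|i s IH /= /andP[si us]].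
  by rewrite !big_nil mulr1.
rewrite !big_cons IH // rhoM -!mulrA; congr (_ * _).
by rewrite !mulrA rho_commute_prod.
Qed.

Definition rep : A -> E := tensor_lift rep_pure.

Lemma rep_pureE a : rep (pure a) = rep_pure a.
Proof. exact/tensor_lift_pure/rep_pure_multilinear. Qed.

Lemma repD : {morph rep : x y / x + y}.
Proof. exact/tensor_liftD/rep_pure_multilinear. Qed.

Lemma repZ r x : rep (r *: x) = r *: rep x.
Proof. exact/tensor_liftZ/rep_pure_multilinear. Qed.

Lemma rep0 : rep 0 = 0.
Proof. exact/tensor_lift0/rep_pure_multilinear. Qed.

Lemma repM : {morph rep : x y / x * y}.
Proof.
move=> x y; move: x; apply: tensor_ind => [a||u v IHu IHv|r u IHu].
- move: y; apply: tensor_ind => [b||u v IHu IHv|r u IHu].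
  + by rewrite [_ * _]tmul_pure !rep_pureE rep_pure_mul.
  + by rewrite mulr0 rep0 mulr0.
  + by rewrite mulrDr !repD IHu IHv mulrDr.
  + by rewrite -ualg_scalerAr !repZ IHu ualg_scalerAr.
- by rewrite mul0r rep0 mul0r.
- by rewrite mulrDl !repD IHu IHv mulrDl.
- by rewrite -ualg_scalerAl !repZ IHu ualg_scalerAl.
Qed.

Lemma rep1 : rep 1 = 1.
Proof.
rewrite [LHS]rep_pureE /rep_pure big1 // => i _; exact: rho1.
Qed.

Definition matrix_unit (u v : mword q) : A :=
  pure (fun i => word_e R (u i) * word_es R (v i)).

Lemma rep_matrix_unit u v : rep (matrix_unit u v) =
  wsub (fun x => (mprefix u x)%:R) (fun x => mcat v (mdrop u x)).
Proof.
(* The prefix replacement restricted to the coordinates in [s], for induction on [s]. *)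
pose mix (s : seq 'I_k) (x : X) : X := fun i =>
  if i \in s then scat (v i) (sdrop (size (u i)) (x i)) else x i.
have step s : uniq s ->
    \prod_(i <- s) rho i (word_e R (u i) * word_es R (v i)) =
    wsub (fun x => (all (fun i => mkseq (x i) (size (u i)) == u i) s)%:R) (mix s).
  elim: s => [_|i s IH /andP[si us]]; first by rewrite big_nil -wsub_one.
  rewrite big_cons IH // rho_word wsub_mul; apply: wsub_eq => x /=.
    rewrite -natrM mulnb; congr (_ && _)%:R; apply: eq_in_all => j js.
    by rewrite upd_out //; apply: contraNneq si => <-.
  move=> _; apply: pointP => j; rewrite /mix inE.
  have [->|ji] := eqVneq j i; first by rewrite (negPf si) upd_in.
  by case: ifP => _; rewrite upd_out.
rewrite rep_pureE /rep_pure step ?index_enum_uniq //; apply: wsub_eq => x.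
  congr (_%:R); congr nat_of_bool; apply/allP/mprefixP => [a i|a i _].
    by apply/eqP/a/mem_index_enum.
  by rewrite a.
by move=> _; apply: pointP => i; rewrite /mix mem_index_enum.
Qed.

End Representation.

(** * Normal forms *)

Lemma linear_span_sum (R : comNzRingType) (V : lmodType R) (S : V -> Prop)
    (I : Type) (s : seq I) (P : pred I) (F : I -> V) :
  (forall i, P i -> linear_span S (F i)) -> linear_span S (\sum_(i <- s | P i) F i).
Proof.
move=> SF; elim/big_rec: _ => [|i x Pi Sx]; first exact: lspan_zero.
exact: lspan_add (SF i Pi) Sx.
Qed.

Section WordSpan.
Variables (R : comNzRingType) (n : nat).
Local Notation L := (leavitt R n).

(** Only the first word has prescribed length: splitting lengthens both words together and cannot
    equalize them. *)
Definition word_unit_of_length N (y : L) :=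
  exists w w', size w = N /\ y = word_e R w * word_es R w'.

Lemma word_span_ge w w' N : (size w <= N)%N ->
  linear_span (word_unit_of_length N) (word_e R w * word_es R w').
Proof.
move=> /subnKC; move: (N - size w)%N => d; elim: d w w' => [|d IH] w w' dN.
  by apply: lspan_gen; exists w, w'; rewrite -dN addn0.
rewrite word_split; apply: linear_span_sum => c _; apply: IH.
by rewrite size_rcons addSnnS.
Qed.

Lemma word_span (x : L) : exists N0, forall N, (N0 <= N)%N ->
  linear_span (word_unit_of_length N) x.
Proof.
pose word_unit (y : L) := exists w w', y = word_e R w * word_es R w'.
have : linear_span word_unit x.
  suff Sx w w' : linear_span word_unit (x * (word_e R w * word_es R w')).
    by have := Sx [::] [::]; rewrite word_e_nil word_es_nil !mulr1.
  elim/leavitt_ind: x w w' => [c|c|r|x y IHx IHy|x y IHx IHy] w w'.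
  - by rewrite mulrA -word_e_cons; apply: lspan_gen; exists (c :: w), w'.
  - case: w => [|c' w].
      by rewrite word_e_nil mul1r -word_es_rcons -[X in linear_span _ X]mul1r
        -word_e_nil; apply: lspan_gen; exists [::], (rcons w' c).
    rewrite word_e_cons !mulrA leavitt_es_e -mulrA; case: (c == c').
      by rewrite mul1r; apply: lspan_gen; exists w, w'.
    by rewrite mul0r; apply: lspan_zero.
  - by rewrite -ualg_scalerAl mul1r; apply/lspan_scale/lspan_gen; exists w, w'.
  - by rewrite mulrDl; apply: lspan_add.
  - rewrite -mulrA; elim: (IHy w w') => {w w'} [_ [w [w' ->]]||z z' _ IHz _ IHz'|r z _ IHz].
    + exact: IHx.
    + by rewrite mulr0; apply: lspan_zero.
    + by rewrite mulrDr; apply: lspan_add.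
    + by rewrite -ualg_scalerAr; apply: lspan_scale.
elim=> {x} [_ [w [w' ->]]||x y _ [N xN] _ [M yM]|r x _ [N xN]].
- by exists (size w) => N; apply: word_span_ge.
- by exists 0%N => *; apply: lspan_zero.
- by exists (maxn N M) => K; rewrite geq_max => /andP[/xN ? /yM ?]; apply: lspan_add.
- by exists N => M /xN; apply: lspan_scale.
Qed.

End WordSpan.

Section NormalForm.
Variables (R : comNzRingType) (k : nat) (q : 'I_k -> nat).
Variable (q_gt1 : forall i, (1 < q i)%N).
Local Notation X := (point q).
Local Notation W := (mword q).
Local Notation A := (tensor (fun i => leavitt R (q i))).
Local Notation rep := (@rep R k q).
Local Notation matrix_unit := (@matrix_unit R k q).
Implicit Types (a b d : A) (u v w : W) (x y z t : X).

Definition unit_of_length N (y : A) :=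
  exists u v, (forall i, size (u i) = N) /\ y = matrix_unit u v.

Lemma tensor_span b : exists N0, forall N, (N0 <= N)%N ->
  linear_span (unit_of_length N) b.
Proof.
elim/tensor_ind: b => [a||x y [N xN] [M yM]|r x [N xN]]; last first.
- by exists N => M /xN; apply: lspan_scale.
- by exists (maxn N M) => K; rewrite geq_max => /andP[/xN ? /yM ?]; apply: lspan_add.
- by exists 0%N => *; apply: lspan_zero.
have [N0 N0P] := fin_all_exists (fun i => word_span (a i)).
exists (\max_i N0 i) => N leN.
have {}N0P i : linear_span (@word_unit_of_length R (q i) N) (a i).
  by apply: N0P; apply: leq_trans leN; apply: leq_bigmax.
(* The list [s] holds the coordinates not yet reduced to one word unit; they are expanded one at a
   time by multilinearity. *)
have [s] : exists s : seq 'I_k, forall i, i \notin s -> word_unit_of_length N (a i).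
  by exists (index_enum 'I_k) => i; rewrite mem_index_enum.
elim: s a N0P => [|i s IH] a aS sP.
  have {}sP i : exists uv : seq 'I_(q i) * seq 'I_(q i),
      size uv.1 = N /\ a i = word_e R uv.1 * word_es R uv.2.
    by have [w [w' ?]] := sP i isT; exists (w, w').
  have [uv uvP] := fin_all_exists sP.
  apply: lspan_gen; exists (fun i => (uv i).1), (fun i => (uv i).2).
  split=> [i|]; first by case: (uvP i).
  by congr pure; apply: functional_extensionality_dep => i; case: (uvP i).
suff dfS (c : leavitt R (q i)) : linear_span (@word_unit_of_length R (q i) N) c ->
    linear_span (unit_of_length N) (pure (dfwith a c) : A).
  have -> : a = dfwith a (a i).
    apply: functional_extensionality_dep => j.
    by have [<-|ij] := eqVneq i j; rewrite ?dfwith_in ?dfwith_out.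
  exact: dfS.
elim=> {c} [c cP||c c' _ IHc _ IHc'|r c _ IHc].
- apply: IH => j.
    by have [<-|ij] := eqVneq i j; rewrite ?dfwith_in ?dfwith_out //; apply: lspan_gen.
  have [<- _|ij js] := eqVneq i j; first by rewrite dfwith_in.
  by rewrite dfwith_out //; apply: sP; rewrite inE negb_or eq_sym ij.
- by rewrite -(scale0r 0) pureZ scale0r; apply: lspan_zero.
- by rewrite pureD; apply: lspan_add.
- by rewrite pureZ; apply: lspan_scale.
Qed.

Definition delta y : X -> R^o := fun x => `[< x = y >]%:R.

Definition matcoef b x y : R := rep b (delta y) x.

Lemma matcoefD a b x y : matcoef (a + b) x y = matcoef a x y + matcoef b x y.
Proof. by rewrite /matcoef repD. Qed.

Lemma matcoefZ r b x y : matcoef (r *: b) x y = r * matcoef b x y.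
Proof. by rewrite /matcoef repZ. Qed.

Lemma matcoef0 x y : matcoef 0 x y = 0.
Proof. by rewrite /matcoef rep0. Qed.

Lemma rep_sum (I : Type) (s : seq I) (F : I -> A) f x :
  rep (\sum_(i <- s) F i) f x = \sum_(i <- s) rep (F i) f x.
Proof.
elim: s => [|i s IH]; first by rewrite !big_nil rep0.
by rewrite !big_cons repD -IH.
Qed.

(** Aperiodicity makes the column [mcat v' t] determine [v'], while the equal lengths make the row
    determine [u']. *)
Lemma matcoef_matrix_unit u v u' v' t : maperiodic t ->
  (forall i, size (u' i) = size (u i)) ->
  matcoef (matrix_unit u v) (mcat u' t) (mcat v' t) = ((u, v) == (u', v'))%:R.
Proof.
move=> tP sz; rewrite /matcoef rep_matrix_unit wsubE /delta.
have -> : mprefix u (mcat u' t) = (u == u').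
  apply/mprefixP/eqP => [uu'|-> i]; last exact: mkseq_scat.
  by apply: mwordP => i; rewrite -uu' -sz mkseq_scat.
rewrite xpair_eqE; have [<-|] := eqVneq u u'; last by rewrite mul0r.
rewrite mul1r mdrop_cat; congr (nat_of_bool _)%:R; apply/asboolP/eqP => [|-> //].
exact: maperiodic_inj.
Qed.

Lemma normal_form b : exists N0, forall N, (N0 <= N)%N -> exists S : seq (W * W),
  [/\ uniq S, forall uv, uv \in S -> forall i, size (uv.1 i) = N &
   forall t, maperiodic t ->
     b = \sum_(uv <- S) matcoef b (mcat uv.1 t) (mcat uv.2 t) *: matrix_unit uv.1 uv.2].
Proof.
have [N0 N0P] := tensor_span b; exists N0 => N /N0P bN.
pose leveled (S : seq (W * W)) := forall uv, uv \in S -> forall i, size (uv.1 i) = N.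
suff [S SN SP] : exists2 S, leveled S & forall S', uniq S' -> leveled S' ->
    {subset S <= S'} -> forall t, maperiodic t ->
    b = \sum_(uv <- S') matcoef b (mcat uv.1 t) (mcat uv.2 t) *: matrix_unit uv.1 uv.2.
  have SN' : leveled (undup S) by move=> uv; rewrite mem_undup; apply: SN.
  exists (undup S); split=> //; first exact: undup_uniq.
  by apply: SP (undup_uniq _) SN' _ => uv; rewrite mem_undup.
elim: bN => {b N0 N0P} [_ [u [v [uN ->]]]||a b _ [S SN SP] _ [S' SN' SP']|r b _ [S SN SP]].
- exists [:: (u, v)] => [uv|S' uS' SN' uvS' t tP]; first by rewrite inE => /eqP->.
  rewrite (bigD1_seq (u, v)) ?uvS' ?inE //= matcoef_matrix_unit // eqxx scale1r.
  rewrite big_seq_cond big1 ?addr0 // => uv /andP[uvS ne].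
  rewrite matcoef_matrix_unit // => [|i]; last by rewrite (SN' _ uvS) uN.
  by rewrite -surjective_pairing eq_sym (negPf ne) scale0r.
- exists [::] => // S' _ _ _ t _.
  by rewrite big1 // => uv _; rewrite matcoef0 scale0r.
- exists (S ++ S') => [uv|S'' uS'' SN'' SS t tP].
    by rewrite mem_cat => /orP[/SN|/SN'].
  rewrite (eq_bigr _ (fun uv _ => congr1 (fun c => c *: _) (matcoefD _ _ _ _))).
  rewrite (eq_bigr _ (fun uv _ => scalerDl _ _ _)) big_split /= -SP -?SP' //.
  + by move=> uv uvS; apply: SS; rewrite mem_cat uvS orbT.
  + by move=> uv uvS; apply: SS; rewrite mem_cat uvS.
- exists S => // S' uS' SN' SS t tP.
  rewrite {1}(SP _ uS' SN' SS _ tP) scaler_sumr; apply: eq_bigr => uv _.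
  by rewrite matcoefZ scalerA.
Qed.

End NormalForm.

(** * The diagonal and its characters *)

Section Diagonal.
Variables (R : comNzRingType) (k : nat) (q : 'I_k -> nat).
Variable (q_gt1 : forall i, (1 < q i)%N).
Local Notation X := (point q).
Local Notation W := (mword q).
Local Notation A := (tensor (fun i => leavitt R (q i))).
Local Notation E := (lin_end (X -> R^o)).
Local Notation rep := (@rep R k q).
Local Notation matrix_unit := (@matrix_unit R k q).
Implicit Types (a b d : A) (u v w : W) (x y z t : X).

Lemma rep_delta_sum (S : seq (W * W)) (c : W * W -> R) f N w t :
  (forall uv, uv \in S -> forall i, size (uv.1 i) = N) -> (forall i, size (w i) = N) ->
  rep (\sum_(uv <- S) c uv *: matrix_unit uv.1 uv.2) f (mcat w t) =
  \sum_(uv <- S | uv.1 == w) c uv * f (mcat uv.2 t).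
Proof.
move=> SN wN; rewrite rep_sum [RHS]big_mkcond /=; apply: eq_big_seq => uv uvS.
rewrite repZ -[LHS]/(c uv * rep (matrix_unit uv.1 uv.2) f (mcat w t)).
rewrite rep_matrix_unit wsubE.
have -> : mprefix uv.1 (mcat w t) = (uv.1 == w).
  apply/mprefixP/eqP => [uw|-> i]; last exact: mkseq_scat.
  by apply: mwordP => i; rewrite -uw SN // -(wN i) mkseq_scat.
have [<-|_] := eqVneq uv.1 w; last by rewrite mul0r mulr0.
by rewrite mul1r mdrop_cat.
Qed.

(** Both coefficients are computed from one normal form, where an aperiodic tail serves only to
    compare words. *)
Lemma normal_form_matcoef b : exists N0, forall N, (N0 <= N)%N ->
  forall w v t t', (forall i, size (w i) = N) -> maperiodic t -> maperiodic t' ->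
  matcoef b (mcat w t) (mcat v t) = matcoef b (mcat w t') (mcat v t').
Proof.
have [N0 N0P] := normal_form b; exists N0 => N /N0P[S [_ SN SE]] w v t t' wN tP t'P.
suff coefE t1 : maperiodic t1 -> matcoef b (mcat w t1) (mcat v t1) =
    \sum_(uv <- S | uv.1 == w) matcoef b (mcat uv.1 t) (mcat uv.2 t) * (uv.2 == v)%:R.
  by rewrite coefE // [RHS]coefE.
move=> t1P; rewrite {1}/matcoef {1}(SE t tP) (rep_delta_sum _ _ _ SN wN).
apply: eq_bigr => uv _; congr (_ * (nat_of_bool _)%:R).
by apply/asboolP/eqP => [|-> //]; apply: maperiodic_inj.
Qed.

(** All coefficients in the normal form of [a - b] vanish. This makes the representation
    faithful. *)
Lemma matcoef_inj a b : (forall x y, matcoef a x y = matcoef b x y) -> a = b.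
Proof.
move=> ab; suff : a - b = 0 by move/eqP; rewrite subr_eq0 => /eqP.
have c0 x y : matcoef (a - b) x y = 0.
  by rewrite matcoefD -scaleN1r matcoefZ ab mulN1r subrr.
have [N0 /(_ _ (leqnn _))[S [_ _ SE]]] := normal_form (a - b).
have [t tP] := maperiodic_exists q_gt1.
by rewrite (SE t tP) big1 // => uv _; rewrite c0 scale0r.
Qed.

Lemma rep_inj a b : rep a = rep b -> a = b.
Proof. by move=> e; apply: matcoef_inj => x y; rewrite /matcoef e. Qed.

Definition diagonal : A -> Prop := tensor_sub (fun i => @leavitt_diag R (q i)).

Definition cyl u : A := matrix_unit u u.

(** A diagonal [d] acts as a multiplication operator, and applying it to the constant 1 reads off
    the multiplier. *)
Definition ev d x : R := rep d (fun=> 1) x.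

Definition mult_op (c : X -> R) : E := wsub c id.

Lemma mult_opD c c' : mult_op c + mult_op c' = mult_op (fun x => c x + c' x).
Proof.
apply: lin_end_eq => f; apply/funext => x.
by rewrite /= /GRing.add /= mulrDl.
Qed.

Lemma mult_opZ r c : r *: mult_op c = mult_op (fun x => r * c x).
Proof.
apply: lin_end_eq => f; apply/funext => x.
by rewrite /= -mulrA.
Qed.

Lemma mult_op0 : 0 = mult_op (fun=> 0).
Proof. by apply: lin_end_eq => f; apply/funext => x; rewrite /= mul0r. Qed.

Lemma mult_opM c c' : mult_op c * mult_op c' = mult_op (fun x => c x * c' x).
Proof. exact: wsub_mul. Qed.

Lemma rho_diag i (a : leavitt R (q i)) : leavitt_diag a ->
  exists c, rho a = mult_op c.
Proof.
elim=> {a} [_ [w ->]||x y _ [c xc] _ [c' yc]|r x _ [c xc]|x y _ [c xc] _ [c' yc]].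
- eexists; rewrite rho_word; apply: wsub_eq => // x.
  case: (mkseq _ _ =P w) => [e _|_]; last by rewrite eqxx.
  by rewrite -{1}e scat_mkseq upd_id.
- by exists (fun=> 1); rewrite rho1 -wsub_one.
- by rewrite rhoD xc yc mult_opD; eexists.
- by rewrite rhoZ xc mult_opZ; eexists.
- by rewrite rhoM xc yc mult_opM; eexists.
Qed.

Lemma rep_diag d : diagonal d -> rep d = mult_op (ev d).
Proof.
move=> dd; suff [c dc] : exists c, rep d = mult_op c.
  rewrite dc; congr mult_op; apply/funext => x.
  by rewrite /ev dc wsubE mulr1.
elim: dd => {d} [_ [a [aD ->]]||x y _ [c xc] _ [c' yc]|r x _ [c xc]].
- rewrite rep_pureE /rep_pure.
  elim/big_rec: _ => [|i e _ [c ->]]; first by exists (fun=> 1); rewrite -wsub_one.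
  by have [c' ->] := rho_diag (aD i); rewrite mult_opM; eexists.
- by exists (fun=> 0); rewrite rep0 -mult_op0.
- by rewrite repD xc yc mult_opD; eexists.
- by rewrite repZ xc mult_opZ; eexists.
Qed.

Lemma rep_diagE d f x : diagonal d -> rep d f x = ev d x * f x.
Proof. by move=> /rep_diag ->. Qed.

Lemma evD a b x : ev (a + b) x = ev a x + ev b x.
Proof. by rewrite /ev repD. Qed.
Lemma evZ r b x : ev (r *: b) x = r * ev b x.
Proof. by rewrite /ev repZ. Qed.
Lemma ev0 x : ev 0 x = 0.
Proof. by rewrite /ev rep0. Qed.
Lemma ev1 x : ev 1 x = 1.
Proof. by rewrite /ev rep1. Qed.
Lemma evM d d' x : diagonal d -> diagonal d' -> ev (d * d') x = ev d x * ev d' x.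
Proof. by move=> dd dd'; rewrite /ev repM lin_mulE rep_diagE. Qed.

Lemma ev_sum (I : Type) (s : seq I) (F : I -> A) x :
  ev (\sum_(i <- s) F i) x = \sum_(i <- s) ev (F i) x.
Proof. exact: rep_sum. Qed.

Lemma diagonal_cyl u : diagonal (cyl u).
Proof.
apply: lspan_gen; exists (fun i => leavitt_proj R (u i)); split=> // i.
by apply: gsub_gen; exists (u i).
Qed.

Lemma ev_cyl u x : ev (cyl u) x = (mprefix u x)%:R.
Proof. by rewrite /ev rep_matrix_unit wsubE mulr1. Qed.

Lemma diagonal1 : diagonal 1.
Proof.
apply: lspan_gen; exists (fun=> 1); split=> // i; exact: gsub_one.
Qed.

Lemma diagonalM d d' : diagonal d -> diagonal d' -> diagonal (d * d').
Proof.
move=> dd dd'; elim: dd => {d} [_ [a [aD ->]]||x y _ Dx _ Dy|r x _ Dx].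
- elim: dd' => {d'} [_ [b [bD ->]]||x y _ Dx _ Dy|r x _ Dx].
  + apply: lspan_gen; exists (Defs.mulf a b); split; last exact: tmul_pure.
    by move=> i; exact: (gsub_mul (aD i) (bD i)).
  + by rewrite mulr0; apply: lspan_zero.
  + by rewrite mulrDr; apply: lspan_add.
  + by rewrite -ualg_scalerAr; apply: lspan_scale.
- by rewrite mul0r; apply: lspan_zero.
- by rewrite mulrDl; apply: lspan_add.
- by rewrite -ualg_scalerAl; apply: lspan_scale.
Qed.

Lemma ev_inj d d' : diagonal d -> diagonal d' -> (forall x, ev d x = ev d' x) -> d = d'.
Proof.
move=> dd dd' e; apply: rep_inj; rewrite !rep_diag //; congr mult_op.
exact/funext.
Qed.

Lemma diagonalC d d' : diagonal d -> diagonal d' -> d * d' = d' * d.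
Proof.
move=> dd dd'; apply: ev_inj => [||x]; try exact: diagonalM.
by rewrite !evM // mulrC.
Qed.

(** A normal form term with [u] different from [v] has its coefficient at the distinct points [u t]
    and [v t]. *)
Lemma diagonal_of_matcoef b : (forall x y, x <> y -> matcoef b x y = 0) -> diagonal b.
Proof.
move=> b0; have [N0 /(_ _ (leqnn _))[S [_ _ SE]]] := normal_form b.
have [t tP] := maperiodic_exists q_gt1.
rewrite (SE t tP); apply: linear_span_sum => uv _.
have [e|ne] := eqVneq uv.1 uv.2.
  by rewrite e; apply/lspan_scale/diagonal_cyl.
rewrite b0 ?scale0r; first exact: lspan_zero.
by move=> /(maperiodic_inj tP)/eqP; rewrite (negPf ne).
Qed.

Lemma diagonal_of_rep b c : rep b = mult_op c -> diagonal b.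
Proof.
move=> bc; apply: diagonal_of_matcoef => x y xy.
by rewrite /matcoef bc wsubE /delta asboolF // mulr0.
Qed.

Lemma mpre_neq x y : x <> y -> exists N, ~~ mprefix (mpre N x) y.
Proof.
move=> xy; apply: contrapT => nN; apply: xy; apply: mpre_inj => N.
have /mprefixP e : mprefix (mpre N x) y.
  by apply/negPn/negP => ne; apply: nN; exists N.
by apply: mwordP => i; rewrite -(e i) size_mkseq.
Qed.

(** Commuting with a cylinder that contains [x] but not [y] kills the coefficient at [(x, y)]. *)
Lemma diagonal_maximal b : (forall d, diagonal d -> b * d = d * b) -> diagonal b.
Proof.
move=> bC; apply: diagonal_of_matcoef => x y xy.
have [N nN] := mpre_neq xy.
have := congr1 (fun a => matcoef a x y) (bC _ (diagonal_cyl (mpre N x))).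
rewrite /matcoef !repM !lin_mulE (rep_diagE _ _ (diagonal_cyl _)).
rewrite ev_cyl mprefix_pre mul1r.
move=> <-; rewrite (_ : rep (cyl _) _ = 0).
  by rewrite lin_fun0.
apply/funext => z; rewrite rep_diagE; last exact: diagonal_cyl.
rewrite ev_cyl /delta; case: asboolP => [->|_]; last by rewrite mulr0.
by rewrite (negPf nN) mul0r.
Qed.

Lemma diagonal_decomposition d : diagonal d -> exists N0, forall N, (N0 <= N)%N ->
  exists S : seq (W * R), (forall p, p \in S -> forall i, size (p.1 i) = N) /\
    d = \sum_(p <- S) p.2 *: cyl p.1.
Proof.
move=> dd; have [N0 N0P] := normal_form d; exists N0 => N /N0P[S [_ SN SE]].
have [t tP] := maperiodic_exists q_gt1.
exists [seq (uv.1, matcoef d (mcat uv.1 t) (mcat uv.2 t)) | uv <- S & uv.1 == uv.2].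
split=> [p /mapP[uv]|]; first by rewrite mem_filter => /andP[_ /SN ?] ->.
rewrite {1}(SE t tP) big_map big_filter [LHS](bigID (fun uv => uv.1 == uv.2)) /=.
rewrite [X in _ + X]big1 ?addr0 => [|uv ne].
  by apply: eq_bigr => uv /eqP e; congr (_ *: matrix_unit _ _).
rewrite /matcoef rep_diagE // /delta asboolF ?mulr0 ?scale0r //.
by move/(maperiodic_inj tP)/eqP; rewrite (negPf ne).
Qed.

Lemma ev_locally_constant d : diagonal d -> exists N, forall x y,
  mpre N x = mpre N y -> ev d x = ev d y.
Proof.
move=> /diagonal_decomposition[N /(_ N (leqnn N))[S [SN ->]]]; exists N => x y xy.
rewrite !ev_sum; apply: eq_big_seq => p pS; rewrite !evZ !ev_cyl.
by rewrite (mpre_prefix _ xy) // => i; rewrite SN.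
Qed.

Lemma ev_separates (zs : seq X) x : exists d, [/\ diagonal d, ev d x = 1 &
  forall z, z \in zs -> z <> x -> ev d z = 0].
Proof.
have [N NP] : exists N, forall z, z \in zs -> z <> x -> ~~ mprefix (mpre N x) z.
  elim: zs => [|z zs [N NP]]; first by exists 0%N.
  have [->|/eqP zx] := eqVneq z x.
    by exists N => z'; rewrite inE => /orP[/eqP->|/NP].
  have [M MP] := mpre_neq (fun e => zx (esym e)).
  exists (maxn N M) => z'; rewrite inE => z'P z'x.
  have pre K : (K <= maxn N M)%N -> mprefix (mpre (maxn N M) x) z' ->
      mprefix (mpre K x) z'.
    move=> le /mprefixP e; apply/mprefixP => i; rewrite size_mkseq.
    by apply: (mkseq_le le); rewrite -[RHS](e i) size_mkseq.
  case/orP: z'P => [/eqP z'z|z'zs].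
    by subst z'; apply: contra MP; apply/pre/leq_maxr.
  by apply: contra (NP _ z'zs z'x); apply/pre/leq_maxl.
exists (cyl (mpre N x)); split; first exact: diagonal_cyl.
  by rewrite ev_cyl mprefix_pre.
by move=> z zzs zx; rewrite ev_cyl (negPf (NP z zzs zx)).
Qed.

Lemma ev_point_inj x y : (forall d, diagonal d -> ev d x = ev d y) -> x = y.
Proof.
move=> e; apply: contrapT => xy.
have [d [dd dx dy]] := ev_separates [:: y] x.
have := e d dd; rewrite dx dy ?inE // => [/eqP|/esym //].
by rewrite oner_eq0.
Qed.

(* Since [R] is indecomposable, a character takes the value 1 on exactly one
   cylinder of each depth, and these cylinders shrink to a point. *)
Lemma character_is_evaluation (HR : indecomposable R) (chi : A -> R) :
  (forall a b, chi (a + b) = chi a + chi b) -> (forall r a, chi (r *: a) = r * chi a) ->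
  chi 1 = 1 ->
  (forall d d', diagonal d -> diagonal d' -> chi (d * d') = chi d * chi d') ->
  exists x, forall d, diagonal d -> chi d = ev d x.
Proof.
move=> chiD chiZ chi1 chiM.
have chi0 : chi 0 = 0 by rewrite -(scale0r 0) chiZ mul0r.
have chi_sum (I : Type) (s : seq I) (F : I -> A) :
    chi (\sum_(i <- s) F i) = \sum_(i <- s) chi (F i).
  by elim: s => [|i s IH]; rewrite ?big_nil // !big_cons chiD IH.
have chi01 u : chi (cyl u) = 0 \/ chi (cyl u) = 1.
  apply: HR; rewrite -chiM; try exact: diagonal_cyl.
  congr chi; apply: ev_inj => [||x]; try exact: diagonal_cyl.
    by apply: diagonalM; apply: diagonal_cyl.
  rewrite evM ?ev_cyl; try exact: diagonal_cyl.
  by rewrite -natrM mulnb andbb.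
have compat u v : chi (cyl u) = 1 -> chi (cyl v) = 1 ->
    exists z, mprefix u z /\ mprefix v z.
  move=> u1 v1; apply: contrapT => nz.
  have /eqP := chiM _ _ (diagonal_cyl u) (diagonal_cyl v).
  rewrite u1 v1 mulr1 (_ : cyl u * cyl v = 0) ?chi0 1?eq_sym ?oner_eq0 //.
  apply: ev_inj => [||x]; first by apply: diagonalM; apply: diagonal_cyl.
    exact: lspan_zero.
  rewrite evM ?ev_cyl ?ev0; try exact: diagonal_cyl.
  rewrite -natrM mulnb; case: andP => // -[ux vx].
  by case: nz; exists x.
have [N0 N0P] := diagonal_decomposition diagonal1.
(* The unit is a combination of cylinders of depth [N0 + M], and [chi] cannot vanish on all of
   them. *)
have [U UP] : exists U : nat -> W, forall M, (forall i, size (U M i) = (N0 + M)%N) /\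
    chi (cyl (U M)) = 1.
  suff /choice[U UP] : forall M : nat, exists u : W,
      (forall i, size (u i) = (N0 + M)%N) /\ chi (cyl u) = 1 by exists U.
  move=> M.
  have [S [SN SE]] := N0P _ (leq_addr M N0).
  apply: contrapT => nu; have /eqP := chi1; rewrite SE chi_sum big_seq big1.
    by rewrite eq_sym oner_eq0.
  move=> p pS; rewrite chiZ; case: (chi01 p.1) => [->|p1]; first by rewrite mulr0.
  by case: nu; exists p.1; split=> //; apply: SN.
pose o : X := fun i _ => Ordinal (ltnW (q_gt1 i)).
(* Letter [M] is taken from [U M.+1], which is long enough to contain it; the filler [o] is never
   read. *)
pose x : X := fun i M => mcat (U M.+1) o i M.
have UP1 M := (UP M).2; have Usz M := (UP M).1.
have Ux M : mprefix (U M) x.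
  apply/mprefixP => i; rewrite -[RHS](mkseq_scat (U M i) (o i)).
  apply/eq_mkseqP => p pM; rewrite /x /mcat.
  have [z [/mprefixP zM /mprefixP zp]] := compat _ _ (UP1 M) (UP1 p.+1).
  have e K : mprefix (U K) z -> (p < size (U K i))%N -> scat (U K i) (o i) p = z i p.
    move=> /mprefixP zK; apply: (eq_mkseqP _ _ _).1.
    by rewrite mkseq_scat zK.
  rewrite !e //; try exact/mprefixP.
  by rewrite Usz addnS ltnS leq_addl.
have chi_cyl u : chi (cyl u) = (mprefix u x)%:R.
  have [M uM] := mword_bound u.
  have uM' i : (size (u i) <= size (U M i))%N by rewrite Usz (leq_trans (uM i)) ?leq_addl.
  have pre z : mprefix (U M) z -> mprefix u z = mprefix u x.
    move=> /mprefixP zU; have /mprefixP xU := Ux M.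
    apply: (mpre_prefix (N := (N0 + M)%N)) => [i|]; first by rewrite -(Usz M i) uM'.
    by apply: mwordP => i; rewrite /mpre -(Usz M i) zU xU.
  case: (chi01 u) => u1; last first.
    have [z [uz Uz]] := compat _ _ u1 (UP1 M).
    by rewrite -(pre z Uz) uz u1.
  case ux: (mprefix u x); last by rewrite u1.
  have := chiM _ _ (diagonal_cyl (U M)) (diagonal_cyl u).
  rewrite u1 mulr0 (_ : cyl (U M) * cyl u = cyl (U M)) ?UP1 1?u1 //.
  apply: ev_inj => [||z]; try exact: diagonal_cyl.
    by apply: diagonalM; apply: diagonal_cyl.
  rewrite evM ?ev_cyl; try exact: diagonal_cyl.
  by rewrite -natrM mulnb; case Uz: (mprefix _ z) => //; rewrite pre // ux.
exists x => d /diagonal_decomposition[N /(_ N (leqnn N))[S [_ ->]]].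
by rewrite chi_sum ev_sum; apply: eq_bigr => p _; rewrite chiZ evZ chi_cyl ev_cyl.
Qed.

End Diagonal.

(** * The homeomorphism of spectra *)

Section DiagonalPreservingHomomorphism.
Variables (R : comNzRingType) (HR : indecomposable R).
Variables (k l : nat) (q : 'I_k -> nat) (r : 'I_l -> nat).
Variables (q_gt1 : forall i, (1 < q i)%N) (r_gt1 : forall j, (1 < r j)%N).
Local Notation A := (tensor (fun i => leavitt R (q i))).
Local Notation B := (tensor (fun j => leavitt R (r j))).
Variable phi : A -> B.
Hypotheses (phiD : {morph phi : x y / x + y}) (phiZ : scalable phi).
Hypotheses (phi1 : phi 1 = 1) (phiM : {morph phi : x y / x * y}).
Hypothesis phi_diag : forall d, diagonal d -> diagonal (phi d).

(** Composing [phi] with evaluation at [y] gives a character of the source diagonal. *)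
Lemma spectrum_map : exists h : point r -> point q,
  forall d y, diagonal d -> ev (phi d) y = ev d (h y).
Proof.
suff /choice[h hP] : forall y : point r, exists x : point q,
    forall d, diagonal d -> ev (phi d) y = ev d x.
  by exists h => d y /hP.
move=> y; apply: (character_is_evaluation q_gt1 HR (chi := fun a => ev (phi a) y)).
- by move=> a b; rewrite phiD evD.
- by move=> s a; rewrite phiZ evZ.
- by rewrite phi1 ev1.
- by move=> d d' dd dd'; rewrite phiM evM //; apply: phi_diag.
Qed.

Variable h : point r -> point q.
Hypothesis hP : forall d y, diagonal d -> ev (phi d) y = ev d (h y).

Lemma spectrum_map_prefixes (S : seq (mword q)) : exists N, forall u, u \in S ->
  forall y y', mpre N y = mpre N y' -> mprefix u (h y) = mprefix u (h y').
Proof.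
elim: S => [|u S [N NP]]; first by exists 0%N.
have [M MP] := ev_locally_constant r_gt1 (phi_diag (diagonal_cyl R u)).
exists (maxn N M) => v; rewrite inE => /orP[/eqP->|vS] y y' yy'.
  have := MP _ _ (mpre_le (leq_maxr N M) yy').
  rewrite !hP ?ev_cyl; try exact: diagonal_cyl.
  by do 2![case: mprefix] => // /eqP; rewrite ?oner_eq0 // eq_sym oner_eq0.
exact: NP vS _ _ (mpre_le (leq_maxl N M) yy').
Qed.

(** Decomposing the unit at depth [N0 + M] puts every [h y] into one of finitely many cylinders, and
    finitely many letters of [y] decide which ones. *)
Lemma spectrum_map_uniformly_continuous : uniformly_continuous h.
Proof.
move=> M; have [N0 N0P] := diagonal_decomposition q_gt1 (diagonal1 R q).
have [S [SN SE]] := N0P _ (leq_addr M N0).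
have [N NP] := spectrum_map_prefixes [seq p.1 | p <- S].
exists N => y y' yy'.
have [p pS py] : exists2 p, p \in S & mprefix p.1 (h y).
  apply: contrapT => np; have /eqP := ev1 R (h y).
  rewrite SE ev_sum big_seq big1 1?eq_sym ?oner_eq0 // => p pS.
  rewrite evZ ev_cyl; case py: (mprefix _ _); last by rewrite mulr0.
  by case: np; exists p.
have py' : mprefix p.1 (h y') by rewrite -(NP _ (map_f _ pS) _ _ yy').
apply: (mpre_le (leq_addl N0 M)); apply: mwordP => i.
move/mprefixP: py => /(_ i); move/mprefixP: py' => /(_ i).
by rewrite SN // /mpre => -> ->.
Qed.

Hypothesis h_inj : injective h.

Local Notation e u v := (matrix_unit R u v : A).

(** Matrix units normalize the diagonal and transport evaluations along the prefix replacement. *)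
Lemma sandwich_diagonal (u v : mword q) p : diagonal p ->
  diagonal (e u v * p * e v u) /\
  forall z, ev (e u v * p * e v u) (mcat u z) = ev p (mcat v z).
Proof.
move=> dp.
have repE : rep (e u v * p * e v u) =
    mult_op (fun x => (mprefix u x)%:R * ev p (mcat v (mdrop u x))).
  rewrite !repM !rep_matrix_unit rep_diag // !wsub_mul; apply: wsub_eq => x /=.
    by rewrite mprefix_cat mulr1.
  case ux: (mprefix u x); last by rewrite !mul0r eqxx.
  by rewrite mdrop_cat mcat_drop.
split; first exact: diagonal_of_rep repE.
by move=> z; rewrite /ev repE wsubE mprefix_cat mdrop_cat mul1r mulr1.
Qed.

(* The matrix of [phi (e u v)] at a generic point has a single nonzero
   entry in each row, and by [normal_form_matcoef] its position depends only on
   finitely many letters. *)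
Lemma spectrum_map_conjugates : conjugates_replacements h.
Proof.
move=> u v; pose n := phi (e u v); pose n' := phi (e v u).
have [Nu NuP] := spectrum_map_prefixes [:: u].
have [N0 N0P] := normal_form n; have [Nn NnP] := normal_form_matcoef n.
(* [Nu] preserves the prefix [u] of [h y], [N0] admits a normal form of [n], and [Nn] makes its
   coefficients independent of the tail. *)
pose N := maxn Nu (maxn N0 Nn).
have NNu : (Nu <= N)%N by apply: leq_maxl.
have NN0 : (N0 <= N)%N by rewrite /N maxnCA leq_maxl.
have NNn : (Nn <= N)%N by rewrite /N maxnA leq_maxr.
have [S [S_uniq SN SE]] := N0P _ NN0.
have [L LP] : exists L, forall ab, ab \in S -> forall i, (size (ab.2 i) <= L)%N.
  elim: (S) => [|ab S' [L LP]]; first by exists 0%N.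
  have [M MP] := mword_bound ab.2; exists (maxn L M) => ab'.
  by rewrite inE => /orP[/eqP->|/LP le] i; rewrite leq_max ?le ?MP ?orbT.
have [Nn' Nn'P] := normal_form_matcoef n'.
pose N1 := maxn L Nn'; exists (N + N1)%N => y uy.
pose a := mpre N y; pose rho := mpre N1 (mdrop a y).
have aN i : size (a i) = N by rewrite size_mkseq.
rewrite mpreD -/a -/rho.
pose Y t := mcat a (mcat rho t).
pose Z (ab : mword r * mword r) t := mcat ab.2 (mcat rho t).
pose W t := mcat v (mdrop u (h (Y t))).
have uY t : mprefix u (h (Y t)).
  rewrite -(NuP u _ y) ?inE //; apply: (mpre_le NNu).
  by rewrite /Y mpre_cat.
have YE t : h (Y t) = mcat u (mdrop u (h (Y t))) by rewrite mcat_drop.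
pose eps ab t := matcoef n (Y t) (Z ab t) * matcoef n' (Z ab t) (Y t).
have eps_const ab t t' : ab \in S -> maperiodic t -> maperiodic t' ->
    eps ab t = eps ab t'.
  move=> abS tP t'P; congr (_ * _).
    by apply: NnP NNn _ _ _ _ aN _ _; apply: maperiodic_cat.
  (* Letters of [rho] complete [ab.2] to length exactly [N1] in every coordinate, where the
     coefficients of [n'] no longer depend on the tail. *)
  pose rho1 : mword r := fun i => take (N1 - size (ab.2 i)) (rho i).
  pose rho2 : mword r := fun i => drop (N1 - size (ab.2 i)) (rho i).
  have splitE (c : mword r) s :
      mcat c (mcat rho s) = mcat (mcatw c rho1) (mcat rho2 s).
    rewrite mcat_catw; congr mcat; rewrite -mcat_catw; congr mcat.
    by apply: mwordP => i; rewrite /mcatw cat_take_drop.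
  rewrite /Z /Y !splitE; apply: Nn'P (leq_maxr L Nn') _ _ _ _ _ _ _;
    try exact: maperiodic_cat.
  move=> i; rewrite size_cat size_takel ?size_mkseq; first last.
    exact: leq_subr.
  by rewrite subnKC // (leq_trans (LP _ abS i)) ?leq_maxl.
pose F := [seq ab <- S | ab.1 == a].
have F_uniq : uniq F by apply: filter_uniq.
have Z_inj t ab ab' : maperiodic t -> ab \in F -> ab' \in F ->
    h (Z ab t) = h (Z ab' t) -> ab = ab'.
  rewrite !mem_filter => tP /andP[/eqP aE _] /andP[/eqP aE' _] /h_inj.
  move/(maperiodic_inj (maperiodic_cat tP)) => e2.
  by rewrite (surjective_pairing ab) (surjective_pairing ab') aE aE' e2.
(* The sandwich turns the value at [W t] into the coefficient of [n * phi p * n'] at [(Y t, Y t)].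
   Row [Y t] of [n] involves only the columns [Z ab t]. *)
have evE t p : maperiodic t -> diagonal p ->
    ev p (W t) = \sum_(ab <- F) eps ab t * ev p (h (Z ab t)).
  move=> tP dp; have [ds sE] := sandwich_diagonal u v dp.
  rewrite -sE -YE -hP //.
  have -> : ev (phi (e u v * p * e v u)) (Y t) =
      matcoef (phi (e u v * p * e v u)) (Y t) (Y t).
    rewrite /matcoef rep_diagE; last exact: phi_diag.
    by rewrite /delta asboolT // mulr1.
  rewrite !phiM -/n -/n' /matcoef !repM !lin_mulE.
  rewrite {1}(SE _ (maperiodic_cat (u := rho) tP)) (rep_delta_sum _ _ _ SN aN) big_filter.
  apply: eq_bigr => ab /eqP abE; rewrite rep_diagE; last exact: phi_diag.
  rewrite hP //.
  by rewrite abE -/(Y t) -/(Z ab t) /eps -mulrA; congr (_ * _); rewrite mulrC.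
(* By [evE], evaluation at [W t] is a combination of evaluations at distinct points; separating
   these points forces one weight to be 1 and the others 0. *)
have picked t : maperiodic t -> exists2 ab, ab \in F &
    [/\ h (Z ab t) = W t, eps ab t = 1 &
      forall ab', ab' \in F -> ab' != ab -> eps ab' t = 0].
  move=> tP.
  have [p [dp pW p0]] := ev_separates R [seq h (Z ab t) | ab <- F] (W t).
  have := evE t p tP dp; rewrite pW => sum1.
  have [ab abF abW] : exists2 ab, ab \in F & h (Z ab t) = W t.
    apply: contrapT => nab; have /eqP := sum1; rewrite big_seq big1 ?oner_eq0 //.
    move=> ab abF; rewrite p0 ?mulr0 ?map_f // => abW.
    by case: nab; exists ab.
  exists ab => //; split=> // [|ab' ab'F ne].
    rewrite sum1 (bigD1_seq ab) //= abW pW mulr1 big_seq_cond big1 ?addr0 //.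
    move=> ab' /andP[ab'F ne]; rewrite p0 ?mulr0 ?map_f // => ab'W.
    by rewrite (Z_inj t ab' ab) ?eqxx // ab'W in ne.
  have [p' [dp' pW' p0']] :=
    ev_separates R (W t :: [seq h (Z ab t) | ab <- F]) (h (Z ab' t)).
  have := evE t p' tP dp'; rewrite p0' ?inE ?eqxx //; last first.
    by rewrite -abW => /(Z_inj t _ _ tP abF ab'F)/esym/eqP; rewrite (negPf ne).
  rewrite (bigD1_seq ab') //= pW' mulr1 big_seq_cond big1 ?addr0 //.
  move=> ab'' /andP[ab''F ne']; rewrite p0' ?mulr0 ?inE ?map_f ?orbT // => e'.
  by rewrite (Z_inj t ab'' ab') ?eqxx // in ne'.
(* The weights do not depend on the aperiodic tail, so the pair found at [t0] works for all of
   them. *)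
have [t0 t0P] := maperiodic_exists r_gt1.
have [ab abF [_ ab1 ab0]] := picked t0 t0P.
have abW t : maperiodic t -> h (Z ab t) = W t.
  move=> tP; have [ab' ab'F [ab'W ab'1 _]] := picked t tP.
  have [<- //|ne] := eqVneq ab' ab.
  have /eqP := ab0 _ ab'F ne; rewrite (eps_const ab' t0 t) ?ab'1 ?oner_eq0 //.
  by move: ab'F; rewrite mem_filter => /andP[].
exists (mcatw ab.2 rho) => t; exists (mdrop u (h (Y t))).
rewrite !mcat_catw -/(Y t) -/(Z ab t); split; first exact: YE.
apply: mpre_inj => M.
have [B BP] := mword_bound u.
have [K KP] := spectrum_map_uniformly_continuous (B + M).
(* An aperiodic approximation of [t]; the identity extends to all [t] by continuity. *)
pose t' := mcat (mpre K t) t0.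
have tt' : mpre K t = mpre K t' by rewrite mpre_cat // => i; rewrite size_mkseq.
have hE (c : mword r) :
    mpre (B + M) (h (mcat c (mcat rho t))) = mpre (B + M) (h (mcat c (mcat rho t'))).
  by apply/KP/mpre_mcat/mpre_mcat.
rewrite (mpre_le (leq_addl B M) (hE ab.2)) -/(Z ab t') abW; last exact: maperiodic_cat.
by apply/mpre_mcat/(mpre_mdrop BP)/esym/hE.
Qed.

End DiagonalPreservingHomomorphism.

Lemma spectra_conjugate (R : comNzRingType) (HR : indecomposable R) (k l : nat)
    (q : 'I_k -> nat) (r : 'I_l -> nat)
    (q_gt1 : forall i, (1 < q i)%N) (r_gt1 : forall j, (1 < r j)%N)
    (phi : {rmorphism tensor (fun i => leavitt R (q i)) ->
                      tensor (fun j => leavitt R (r j))}) :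
  scalable phi -> bijective phi -> (forall d, diagonal d -> diagonal (phi d)) ->
  exists (h : point r -> point q) (g : point q -> point r),
    [/\ cancel h g, cancel g h, uniformly_continuous h /\ uniformly_continuous g &
      conjugates_replacements h /\ conjugates_replacements g].
Proof.
move=> phiZ [psi phiK psiK] phi_diag.
have phiI := can_inj phiK.
have psiD : {morph psi : x y / x + y}.
  by move=> x y; apply: phiI; rewrite rmorphD !psiK.
have psiM : {morph psi : x y / x * y}.
  by move=> x y; apply: phiI; rewrite rmorphM !psiK.
have psi1 : psi 1 = 1 by apply: phiI; rewrite rmorph1 psiK.
have psiZ : scalable psi by move=> s x; apply: phiI; rewrite phiZ !psiK.
(* [psi d] commutes with the source diagonal, since [d] commutes with its image; maximality
   concludes. *)
have psi_diag d : diagonal d -> diagonal (psi d).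
  move=> dd; apply: (diagonal_maximal q_gt1) => d' dd'.
  apply: phiI; rewrite !rmorphM psiK; apply: (diagonalC r_gt1 dd); exact: phi_diag.
have phiD := rmorphD phi; have phiM := rmorphM phi; have phi1 := rmorph1 phi.
have [h hP] := spectrum_map HR q_gt1 phiD phiZ phi1 phiM phi_diag.
have [g gP] := spectrum_map HR r_gt1 psiD psiZ psi1 psiM psi_diag.
have hK : cancel h g.
  move=> y; apply: (ev_point_inj (R := R)) => d dd.
  by rewrite -gP // -hP ?psiK //; apply: psi_diag.
have gK : cancel g h.
  move=> x; apply: (ev_point_inj (R := R)) => d dd.
  by rewrite -hP // -gP ?phiK //; apply: phi_diag.
exists h, g; split=> //; split.
- exact: spectrum_map_uniformly_continuous phi_diag _ hP.
- exact: spectrum_map_uniformly_continuous psi_diag _ gP.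
- exact: spectrum_map_conjugates phiM phi_diag _ hP (can_inj hK).
- exact: spectrum_map_conjugates psiM psi_diag _ gP (can_inj gK).
Qed.

Theorem proposition6p3 (R : comNzRingType) (HR : indecomposable R)
    (k l : nat) (k_gt0 : (0 < k)%N) (l_gt0 : (0 < l)%N)
    (n : k.-tuple nat) (m : l.-tuple nat)
    (n_incr : sorted leq n) (m_incr : sorted leq m)
    (n_ge2 : forall i, (2 <= tnth n i)%N) (m_ge2 : forall j, (2 <= tnth m j)%N) :
  (exists phi : {rmorphism leavitt_tensor R n -> leavitt_tensor R m},
     [/\ scalable phi, bijective phi &
         forall x, diag_tensor x -> diag_tensor (phi x)]) ->
  k = l /\ (n = m :> seq nat).
Proof.
move=> [phi [phiZ phi_bij phi_diag]].
have [h [g [hK gK [h_cont g_cont] [h_conj g_conj]]]] :=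
  spectra_conjugate HR n_ge2 m_ge2 phiZ phi_bij phi_diag.
have [sigma sI sP] := slice_injection n_ge2 m_ge2 gK hK g_cont h_cont g_conj h_conj.
have [tau tI tP] := slice_injection m_ge2 n_ge2 hK gK h_cont g_cont h_conj g_conj.
(* [b.-1] is positive, so divisibility yields an inequality. *)
have le_of_dvd a b : (1 < a)%N -> (1 < b)%N -> (a.-1 %| b.-1)%N -> (a <= b)%N.
  by move=> a1 b1 /dvdn_leq; lia.
by apply: (tuple_eq_from_injections n_incr m_incr sI tI) => i; apply: le_of_dvd.
Qed.
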